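(* Any simple Toeplitz subshift satisfies the leading sequence condition (LSC). In particular, all locally constant cocycles over simple Toeplitz subshifts are uniform: if $(\Omega,T)$ is a simple Toeplitz subshift and $A:\Omega\to SL(2,\mathbb{R})$ is locally constant, then $\lim_{n\to\infty}\frac1n\log\|A(n,\omega)\|$ exists for all $\omega\in\Omega$ and the convergence is uniform on $\Omega$ (to a single number $\Lambda$).
   Context: Simple Toeplitz subshifts. Let $\mathcal{A}$ be a finite alphabet, $(a_k)_{k\ge0}$ a sequence in $\mathcal{A}$ and $(n_k)_{k\ge0}$ a sequence of integers with $n_k\ge2$ (the coding sequences). The eventual alphabet $\widetilde{\mathcal{A}}$ is the set of letters occurring infinitely often in $(a_k)$; it is always assumed that $\#\widetilde{\mathcal{A}}\ge2$ and $a_{k+1}\ne a_k$ for all $k$. Define words $p^{(-1)}=\epsilon$ (empty word) and $p^{(k+1)}=p^{(k)}a_{k+1}p^{(k)}\ldots p^{(k)}a_{k+1}p^{(k)}$ for $k\ge-1$, with exactly $n_{k+1}$ blocks $p^{(k)}$ and $n_{k+1}-1$ letters $a_{k+1}$. Each $p^{(k)}$ is a prefix of $p^{(k+1)}$, and $p^{(\infty)}=\lim_k p^{(k)}$ is a one-sided infinite word. The simple Toeplitz subshift is $\Omega=\{\omega\in\mathcal{A}^{\mathbb{Z}}:$ every finite word occurring in $\omega$ occurs in $p^{(\infty)}\}$ with the shift $(T\omega)(n)=\omega(n+1)$. $\mathcal{W}(\Omega)_n$ denotes the set of all words $\omega(k)\ldots\omega(k+n-1)$ with $\omega\in\Omega$,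 $k\in\mathbb{Z}$. A function $A$ on $\Omega$ is locally constant if there is $N\in\mathbb{N}$ such that $A(\omega)=A(\varrho)$ whenever $\omega(-N)\ldots\omega(N)=\varrho(-N)\ldots\varrho(N)$. For $A:\Omega\to SL(2,\mathbb{R})$ the cocycle is $A(n,\omega)=A(T^{n-1}\omega)\cdots A(\omega)$ for $n>0$, $A(0,\omega)=\mathrm{Id}$, and $A(n,\omega)=A(T^{n}\omega)^{-1}\cdots A(T^{-1}\omega)^{-1}$ for $n<0$. $\|\cdot\|$ is the operator norm induced by the Euclidean norm on $\mathbb{R}^2$. Leading sequence condition (LSC) for a subshift $(\Omega,T)$: there exist $r\in\mathbb{N}$ and $\omega^{(1)},\ldots,\omega^{(r)}\in\Omega$ such that: ($\alpha$) there is $N\in\mathbb{N}$ with $\mathcal{W}(\Omega)_n=\bigcup_{j=1}^r\{\omega^{(j)}(-k+1)\ldots\omega^{(j)}(-k+n):k=0,\ldots,n\}$ for all $n\ge N$; and for every locally constant $A:\Omega\to SL(2,\mathbb{R})$: ($\beta$) for every $j$ the limits $\lim_{n\to\infty}\frac{\log\|A(n,\omega^{(j)})\|}{|n|}$ and $\lim_{n\to-\infty}\frac{\log\|A(n,\omega^{(j)})\|}{|n|}$ exist, and all these limits (over all $j$ and both signs) have the same value; ($\gamma$) for every $j$ and every $v\in\mathbb{R}^2\setminus\{0\}$, at most one of the two limits $\lim_{n\to\pm\infty}\frac1{|n|}\log\|A(n,\omega^{(j)})v\|$ is negative (i.e. it is not the case that both limits exist and are negative). *)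

(* Defs.v *)
From mathcomp Require Export all_boot all_order all_algebra.
From mathcomp Require Export all_classical all_reals all_analysis.
Export Order.TTheory GRing.Theory Num.Theory numFieldNormedType.Exports.

#[export] Set Implicit Arguments.
#[export] Unset Strict Implicit.
#[export] Unset Printing Implicit Defensive.

Local Open Scope classical_set_scope.
Local Open Scope ring_scope.

Definition word (Alph : Type) (w : int -> Alph) (k : int) (m : nat) : seq Alph :=
  mkseq (fun i => w (k + i%:Z)) m.

Definition word1 (Alph : Type) (u : nat -> Alph) (k m : nat) : seq Alph :=
  mkseq (fun i => u (k + i)%N) m.

Definition eventual_alphabet (Alph : finType) (a : nat -> Alph) : {set Alph} :=
  [set b | `[< forall N : nat, exists2 k, (N <= k)%N & a k = b >]]%SET.

(* The index is shifted by one: [toeplitz_word a n k] is the word p^(k-1), so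
   [toeplitz_word a n 0] is the empty word p^(-1), and p^(k) is made of n_k
   copies of p^(k-1) separated by n_k - 1 letters a_k. *)
Fixpoint toeplitz_word (Alph : Type) (a : nat -> Alph) (n : nat -> nat) (k : nat) :
    seq Alph :=
  if k is k'.+1 then
    let p := toeplitz_word a n k' in
    p ++ flatten (nseq (n k').-1 (a k' :: p))
  else [::].

(* The i-th letter of p^(oo) is read off p^(i), which has more than i letters
   when all n_k >= 2; see [toeplitz_limitP]. The letter [a 0] is only the
   default value of [nth]. *)
Definition toeplitz_limit (Alph : Type) (a : nat -> Alph) (n : nat -> nat) (i : nat) :
    Alph :=
  nth (a 0) (toeplitz_word a n i.+1) i.

Definition toeplitz_subshift (Alph : Type) (a : nat -> Alph) (n : nat -> nat) :
    set (int -> Alph) :=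
  [set w | forall (k : int) (m : nat),
     exists l : nat, word w k m = word1 (toeplitz_limit a n) l m].

(* [shift k] is the k-th power T^k of the shift, for k of either sign. *)
Definition shift (Alph : Type) (k : int) (w : int -> Alph) : int -> Alph :=
  fun i => w (i + k).

Definition factors (Alph : Type) (Omega : set (int -> Alph)) (m : nat) :
    set (seq Alph) :=
  [set u | exists2 w, Omega w & exists k : int, u = word w k m].

(* A function on Omega is represented by a function on all bi-infinite words;
   only its values on Omega matter below. *)
Definition locally_constant (Alph V : Type) (Omega : set (int -> Alph))
    (A : (int -> Alph) -> V) : Prop :=
  exists N : nat, forall w v, Omega w -> Omega v ->
    (forall i : int, - N%:Z <= i <= N%:Z -> w i = v i) -> A w = A v.

Definition SL2_valued (R : realType) (Alph : Type) (Omega : set (int -> Alph))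
    (A : (int -> Alph) -> 'M[R]_2) : Prop :=
  forall w, Omega w -> \det (A w) = 1.

Fixpoint forward_cocycle (R : realType) (Alph : Type)
    (A : (int -> Alph) -> 'M[R]_2) (m : nat) (w : int -> Alph) : 'M[R]_2 :=
  if m is m'.+1 then A (shift m'%:Z w) *m forward_cocycle A m' w else 1%:M.

Fixpoint backward_cocycle (R : realType) (Alph : Type)
    (A : (int -> Alph) -> 'M[R]_2) (m : nat) (w : int -> Alph) : 'M[R]_2 :=
  if m is m'.+1 then
    invmx (A (shift (- m%:Z) w)) *m backward_cocycle A m' w
  else 1%:M.

Definition cocycle (R : realType) (Alph : Type) (A : (int -> Alph) -> 'M[R]_2)
    (z : int) (w : int -> Alph) : 'M[R]_2 :=
  match z with
  | Posz m => forward_cocycle A m w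
  | Negz m => backward_cocycle A m.+1 w
  end.

(* The library's norm on matrices is the maximum norm, hence the Euclidean
   norm and its operator norm are defined here. *)
Definition euclidean_norm (R : realType) (v : 'cV[R]_2) : R :=
  Num.sqrt (\sum_i v i 0 ^+ 2).

Definition operator_norm (R : realType) (M : 'M[R]_2) : R :=
  sup [set euclidean_norm (M *m v) | v in [set v | euclidean_norm v = 1]].

Definition growth (R : realType) (Alph : Type) (A : (int -> Alph) -> 'M[R]_2)
    (w : int -> Alph) (z : int) : R :=
  ln (operator_norm (cocycle A z w)) / `|z|%:~R.

Definition vector_growth (R : realType) (Alph : Type) (A : (int -> Alph) -> 'M[R]_2)
    (w : int -> Alph) (v : 'cV[R]_2) (z : int) : R :=
  ln (euclidean_norm (cocycle A z w *m v)) / `|z|%:~R.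

Definition LSC_alpha (Alph : Type) (Omega : set (int -> Alph)) (r : nat)
    (om : 'I_r -> int -> Alph) : Prop :=
  exists N : nat, forall m : nat, (N <= m)%N ->
    factors Omega m =
    \bigcup_(j : 'I_r)
      [set word (om j) (- k%:Z + 1) m | k in [set k : nat | (k <= m)%N]].

Definition LSC_beta (R : realType) (Alph : Type) (r : nat)
    (om : 'I_r -> int -> Alph) (A : (int -> Alph) -> 'M[R]_2) : Prop :=
  exists L : R, forall j : 'I_r,
    growth A (om j) m%:Z @[m --> \oo] --> L /\
    growth A (om j) (- m%:Z) @[m --> \oo] --> L.

(* For a locally constant A the two sequences are bounded, so that the only
   possible limits are real numbers. *)
Definition LSC_gamma (R : realType) (Alph : Type) (r : nat)
    (om : 'I_r -> int -> Alph) (A : (int -> Alph) -> 'M[R]_2) : Prop :=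
  forall (j : 'I_r) (v : 'cV[R]_2), v != 0 ->
    ~ exists l1 l2 : R,
        [/\ vector_growth A (om j) v m%:Z @[m --> \oo] --> l1, l1 < 0,
            vector_growth A (om j) v (- m%:Z) @[m --> \oo] --> l2 & l2 < 0].

Definition leading_sequence_condition (R : realType) (Alph : Type)
    (Omega : set (int -> Alph)) : Prop :=
  exists (r : nat) (om : 'I_r -> int -> Alph),
    [/\ (0 < r)%N,
        (forall j, Omega (om j)),
        LSC_alpha Omega om
      & forall A : (int -> Alph) -> 'M[R]_2,
          SL2_valued Omega A -> locally_constant Omega A ->
          LSC_beta om A /\ LSC_gamma om A].

Definition uniform_cocycle (R : realType) (Alph : choiceType)
    (Omega : set (int -> Alph)) (A : (int -> Alph) -> 'M[R]_2) : Prop :=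
  exists Lambda : R,
    {uniform Omega, (fun (m : nat) (w : int -> Alph) => growth A w m%:Z) @ \oo -->
       (fun=> Lambda)}.

Lemma size_toeplitz_word (Alph : Type) (a : nat -> Alph) (n : nat -> nat) (k : nat) :
  (forall k, 2 <= n k)%N -> (k <= size (toeplitz_word a n k))%N.
Proof.
move=> n2; elim: k => //= k IH.
have := n2 k; case: (n k) => [|[|m]] // _.
by rewrite /= size_cat /= addnS ltnS -[X in (X <= _)%N]addn0 leq_add.
Qed.

Lemma prefix_toeplitz_word (Alph : eqType) (a : nat -> Alph) (n : nat -> nat)
    (k l : nat) :
  (k <= l)%N -> prefix (toeplitz_word a n k) (toeplitz_word a n l).
Proof.
move=> /subnK <-; elim: (l - k)%N => [|m IH]; first exact: prefix_refl.
exact: (prefix_trans IH (prefix_prefix _ _)).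
Qed.

Lemma toeplitz_limitP (Alph : eqType) (a : nat -> Alph) (n : nat -> nat) (k i : nat) :
  (forall k, 2 <= n k)%N -> (i < size (toeplitz_word a n k))%N ->
  toeplitz_limit a n i = nth (a 0) (toeplitz_word a n k) i.
Proof.
move=> n2 ik; rewrite /toeplitz_limit.
have ii : (i < size (toeplitz_word a n i.+1))%N by exact: size_toeplitz_word.
case: (leqP i.+1 k) => [|/ltnW] /(prefix_toeplitz_word a n) /prefixP[s ->].
  by rewrite nth_cat ii.
by rewrite nth_cat ik.
Qed.

Lemma shift_toeplitz_subshift (Alph : Type) (a : nat -> Alph) (n : nat -> nat)
    (k : int) (w : int -> Alph) :
  toeplitz_subshift a n w -> toeplitz_subshift a n (shift k w).
Proof.
move=> Ow l m; have [p pE] := Ow (l + k) m; exists p; rewrite -pE.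
by apply: eq_mkseq => i; rewrite /shift addrAC.
Qed.

(* Main.v *)
Require Import Defs.
From mathcomp Require Import ring lra zify.

(* The letter of p^(oo) at position i is a_{level(i + 1)}, where level(q) is the
   largest k such that ell k = n_0 ... n_(k-1) divides q. The leading sequences
   are the words i |-> a_{level |i|} with a letter c of the eventual alphabet at 0.

   Along the blocks p^(k) c the cocycle is E_c X_k with E_c independent of k and
   X_{k+1} = X_k (E_{a_k} X_k)^(n_k - 1), so ln |X_k| / ell k converges to some
   Lam >= 0. If Lam > 0, Cayley-Hamilton turns the growth of the powers into
   growth of the trace of X_k E_{a_k}; hence some direction s is contracted by all
   X_k, and some u by all X_k^-1. If E_c u were parallel to s with a_k = c for
   infinitely many k, Cayley-Hamilton for E_c X_k would contradict the large trace.
   So E_c u and s make a positive angle and |X_k E_c X_k| is almost |X_k|^2 for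
   every eventual c: no cancellation occurs between consecutive blocks, which
   yields uniform growth from below, and (beta) follows. (gamma) is Gordon's
   three-block argument. *)

Local Open Scope classical_set_scope.
Local Open Scope ring_scope.

Local Notation enorm := euclidean_norm.

(** * Matrices of SL(2,R) *)

Section PlaneMatrices.
Variable R : realType.
Implicit Types (M P : 'M[R]_2) (v w : 'cV[R]_2) (c : R).

Lemma sum_ord2 (f : 'I_2 -> R) : \sum_i f i = f 0 + f 1.
Proof.
by rewrite !big_ord_recl big_ord0 addr0; congr (_ + f _); apply: val_inj.
Qed.

Lemma ord2_ind (Q : 'I_2 -> Prop) : Q 0 -> Q 1 -> forall i, Q i.
Proof.
move=> Q0 Q1 [[|[|//]] lti].
  by rewrite (_ : Ordinal lti = 0) //; apply: val_inj.
by rewrite (_ : Ordinal lti = 1) //; apply: val_inj.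
Qed.

Lemma mul_mx2E M P i j : (M *m P) i j = M i 0 * P 0 j + M i 1 * P 1 j.
Proof. by rewrite mxE sum_ord2. Qed.

Lemma mul_cv2E M v i j : (M *m v) i j = M i 0 * v 0 j + M i 1 * v 1 j.
Proof. by rewrite mxE sum_ord2. Qed.

Lemma tr_mx2E M : \tr M = M 0 0 + M 1 1.
Proof. by rewrite /mxtrace sum_ord2. Qed.

Lemma det_mx2E M : \det M = M 0 0 * M 1 1 - M 0 1 * M 1 0.
Proof.
rewrite (expand_det_row _ 0) sum_ord2 /cofactor !det_mx11 !mxE /=.
have -> : lift 0 0 = 1 :> 'I_2 by apply: val_inj.
have -> : lift 1 0 = 0 :> 'I_2 by apply: val_inj.
by rewrite /= !add0n expr0 expr1; ring.
Qed.

Lemma eq_mx2 M P : M 0 0 = P 0 0 -> M 0 1 = P 0 1 -> M 1 0 = P 1 0 ->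
  M 1 1 = P 1 1 -> M = P.
Proof. by move=> ????; apply/matrixP; do 2!elim/ord2_ind. Qed.

Lemma eq_cv2 v w : v 0 0 = w 0 0 -> v 1 0 = w 1 0 -> v = w.
Proof. by move=> ??; apply/matrixP => i j; rewrite ord1; elim/ord2_ind: i. Qed.

Lemma sl2_unit M : \det M = 1 -> M \in unitmx.
Proof. by move=> dM; rewrite unitmxE dM unitr1. Qed.

(** The adjugate; in ['I_2] the index [1 - i] is the other one. *)
Definition adj2 M : 'M[R]_2 :=
  \matrix_(i, j) (if i == j then M (1 - i) (1 - i) else - M i j).

Lemma adj2E M : (adj2 M 0 0 = M 1 1) * (adj2 M 0 1 = - M 0 1) *
  (adj2 M 1 0 = - M 1 0) * (adj2 M 1 1 = M 0 0).
Proof. by rewrite !mxE /= subr0 subrr. Qed.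

Lemma sl2_inv M : \det M = 1 -> invmx M = adj2 M.
Proof.
move=> dM; have uM := sl2_unit dM; rewrite det_mx2E in dM.
rewrite -[LHS]mulmx1 (_ : 1%:M = M *m adj2 M); first by rewrite mulmxA mulVmx ?mul1mx.
by apply: eq_mx2; rewrite !mul_mx2E !adj2E !mxE /= ?mulr1n ?mulr0n -?dM; ring.
Qed.

Lemma det_invmx1 M : \det M = 1 -> \det (invmx M) = 1.
Proof. by move=> dM; rewrite det_inv dM invr1. Qed.

Lemma det_mulmx1 M P : \det M = 1 -> \det P = 1 -> \det (M *m P) = 1.
Proof. by move=> dM dP; rewrite det_mulmx dM dP mulr1. Qed.

Lemma invmxM M P : \det M = 1 -> \det P = 1 ->
  invmx (M *m P) = invmx P *m invmx M.
Proof.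
move=> dM dP; rewrite !sl2_inv ?det_mulmx1 //.
by apply: eq_mx2; rewrite !(mul_mx2E, adj2E); ring.
Qed.

Lemma det_expmx1 M k : \det M = 1 -> \det (M ^+ k) = 1.
Proof.
by move=> dM; elim: k => [|k IH]; rewrite ?expr0 ?det1 // exprS -mulmxE det_mulmx1.
Qed.

Lemma mulmx_expr_swap M P k : (M *m P) ^+ k *m M = M *m (P *m M) ^+ k.
Proof.
elim: k => [|k IH]; first by rewrite mulmx1 mul1mx.
by rewrite !exprS -!mulmxE -mulmxA IH !mulmxA.
Qed.

Lemma invmx_expr M k : \det M = 1 -> invmx (M ^+ k) = invmx M ^+ k.
Proof.
move=> dM; elim: k => [|k IH]; first by rewrite !expr0 invmx1.
by rewrite exprSr exprS -!mulmxE invmxM ?det_expmx1 // IH.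
Qed.

(** Cayley-Hamilton, with [P] of any width so that it serves vectors as well as powers of [M]. *)
Lemma sl2_cayley M p (P : 'M[R]_(2, p)) :
  \det M = 1 -> M *m (M *m P) + P = \tr M *: (M *m P).
Proof.
rewrite det_mx2E => dM; suff MM : M *m M + 1%:M = \tr M *: M.
  by rewrite mulmxA -[X in _ + X]mul1mx -mulmxDl MM scalemxAl.
by apply: eq_mx2; rewrite [LHS]mxE [in RHS]mxE !mul_mx2E tr_mx2E !mxE /=
  ?mulr1n ?mulr0n -?dM; ring.
Qed.

Lemma sqr_enorm v : enorm v ^+ 2 = v 0 0 ^+ 2 + v 1 0 ^+ 2.
Proof. by rewrite sqr_sqrtr sum_ord2 // addr_ge0 ?sqr_ge0. Qed.

Lemma enorm_ge0 v : 0 <= enorm v. Proof. exact: sqrtr_ge0. Qed.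

Definition vdot v w : R := v 0 0 * w 0 0 + v 1 0 * w 1 0.
Definition vwedge v w : R := v 0 0 * w 1 0 - v 1 0 * w 0 0.

Lemma lagrange2 v w : vdot v w ^+ 2 + vwedge v w ^+ 2 = (enorm v * enorm w) ^+ 2.
Proof. by rewrite exprMn !sqr_enorm /vdot /vwedge; ring. Qed.

Lemma ler_sqr0 (x y : R) : 0 <= y -> x ^+ 2 <= y ^+ 2 -> x <= y.
Proof. by nra. Qed.

Lemma vdot_le v w : `|vdot v w| <= enorm v * enorm w.
Proof.
apply: ler_sqr0; first by rewrite mulr_ge0 ?enorm_ge0.
by rewrite real_normK ?num_real // -lagrange2 lerDl sqr_ge0.
Qed.

Lemma vwedge_le v w : `|vwedge v w| <= enorm v * enorm w.
Proof.
apply: ler_sqr0; first by rewrite mulr_ge0 ?enorm_ge0.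
by rewrite real_normK ?num_real // -lagrange2 lerDr sqr_ge0.
Qed.

Lemma enormZ c v : enorm (c *: v) = `|c| * enorm v.
Proof.
apply/eqP; rewrite -(@eqrXn2 _ 2) ?mulr_ge0 ?enorm_ge0 //.
by rewrite exprMn !sqr_enorm !mxE real_normK ?num_real //; apply/eqP; ring.
Qed.

Lemma enormD v w : enorm (v + w) <= enorm v + enorm w.
Proof.
apply: ler_sqr0; first by rewrite addr_ge0 ?enorm_ge0.
have /(le_trans (ler_norm _)) := vdot_le v w.
by rewrite sqrrD !sqr_enorm !mxE /vdot; lra.
Qed.

Lemma enormN v : enorm (- v) = enorm v.
Proof. by rewrite -scaleN1r enormZ normrN1 mul1r. Qed.

Lemma enorm0 : enorm (0 : 'cV[R]_2) = 0.
Proof. by rewrite -(scale0r 0) enormZ normr0 mul0r. Qed.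

Lemma enorm_eq0 v : (enorm v == 0) = (v == 0).
Proof.
apply/eqP/eqP => [v0|->]; last exact: enorm0.
have := sqr_enorm v; rewrite v0 => e.
by apply: eq_cv2; rewrite mxE; nra.
Qed.

Lemma enorm_gt0 v : (0 < enorm v) = (v != 0).
Proof. by rewrite lt_def enorm_ge0 enorm_eq0 andbT. Qed.

Lemma vwedge_mul M v w : vwedge (M *m v) (M *m w) = \det M * vwedge v w.
Proof. by rewrite /vwedge !mul_cv2E det_mx2E; ring. Qed.

(* The Frobenius norm replaces the operator norm, which it approximates within a
   factor 2, because it is explicit and invariant under inversion in SL2. *)
Definition fnorm M : R :=
  Num.sqrt (M 0 0 ^+ 2 + M 0 1 ^+ 2 + M 1 0 ^+ 2 + M 1 1 ^+ 2).

Lemma fnorm_ge0 M : 0 <= fnorm M. Proof. exact: sqrtr_ge0. Qed.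

Lemma sqr_fnorm M :
  fnorm M ^+ 2 = M 0 0 ^+ 2 + M 0 1 ^+ 2 + M 1 0 ^+ 2 + M 1 1 ^+ 2.
Proof. by rewrite sqr_sqrtr // !addr_ge0 ?sqr_ge0. Qed.

Lemma enorm_mul M v : enorm (M *m v) <= fnorm M * enorm v.
Proof.
apply: ler_sqr0; first by rewrite mulr_ge0 ?enorm_ge0 ?fnorm_ge0.
rewrite exprMn !sqr_enorm sqr_fnorm !mul_cv2E.
set a := M 0 0; set b := M 0 1; set c := M 1 0; set d := M 1 1.
set x := v 0 0; set y := v 1 0.
have := sqr_ge0 (a * y - b * x); have := sqr_ge0 (c * y - d * x).
by lra.
Qed.

Lemma fnorm_mul M P : fnorm (M *m P) <= fnorm M * fnorm P.
Proof.
apply: ler_sqr0; first by rewrite mulr_ge0 ?fnorm_ge0.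
rewrite exprMn !sqr_fnorm !mul_mx2E.
set a := M 0 0; set b := M 0 1; set c := M 1 0; set d := M 1 1.
set x := P 0 0; set y := P 0 1; set z := P 1 0; set t := P 1 1.
have := sqr_ge0 (a * z - b * x); have := sqr_ge0 (a * t - b * y).
have := sqr_ge0 (c * z - d * x); have := sqr_ge0 (c * t - d * y).
by lra.
Qed.

Lemma fnorm_inv M : \det M = 1 -> fnorm (invmx M) = fnorm M.
Proof.
move=> dM; rewrite sl2_inv // /fnorm !adj2E; congr Num.sqrt; ring.
Qed.

Lemma fnormD M P : fnorm (M + P) <= fnorm M + fnorm P.
Proof.
apply: ler_sqr0; first by rewrite addr_ge0 ?fnorm_ge0.
have : M 0 0 * P 0 0 + M 0 1 * P 0 1 + M 1 0 * P 1 0 + M 1 1 * P 1 1 <=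
    fnorm M * fnorm P.
  apply: ler_sqr0; first by rewrite mulr_ge0 ?fnorm_ge0.
  rewrite exprMn !sqr_fnorm.
  set a := M 0 0; set b := M 0 1; set c := M 1 0; set d := M 1 1.
  set x := P 0 0; set y := P 0 1; set z := P 1 0; set t := P 1 1.
  have := sqr_ge0 (a * y - b * x); have := sqr_ge0 (a * z - c * x).
  have := sqr_ge0 (a * t - d * x); have := sqr_ge0 (b * z - c * y).
  have := sqr_ge0 (b * t - d * y); have := sqr_ge0 (c * t - d * z).
  by lra.
by rewrite sqrrD !sqr_fnorm !mxE; lra.
Qed.

Lemma fnormZ c M : fnorm (c *: M) = `|c| * fnorm M.
Proof.
apply/eqP; rewrite -(@eqrXn2 _ 2) ?mulr_ge0 ?fnorm_ge0 //.
by rewrite exprMn !sqr_fnorm !mxE real_normK ?num_real //; apply/eqP; ring.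
Qed.

Lemma sqr_fnorm_ge2 M : \det M = 1 -> 2 <= fnorm M ^+ 2.
Proof.
rewrite det_mx2E sqr_fnorm.
by have := sqr_ge0 (M 0 0 - M 1 1); have := sqr_ge0 (M 0 1 + M 1 0); lra.
Qed.

Lemma fnorm_ge1 M : \det M = 1 -> 1 <= fnorm M.
Proof. by move=> /sqr_fnorm_ge2; have := fnorm_ge0 M; nra. Qed.

Lemma fnorm1_le M : \det M = 1 -> fnorm 1%:M <= fnorm M.
Proof.
move=> /sqr_fnorm_ge2 F2; apply: ler_sqr0; rewrite ?fnorm_ge0 //.
apply: le_trans F2; rewrite sqr_fnorm !mxE /= mulr1n mulr0n; lra.
Qed.

Lemma tr_le_fnorm M : `|\tr M| <= 2 * fnorm M.
Proof.
apply: ler_sqr0; first by rewrite mulr_ge0 ?fnorm_ge0.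
rewrite real_normK ?num_real // exprMn sqr_fnorm tr_mx2E.
have := sqr_ge0 (M 0 0 - M 1 1); have := sqr_ge0 (M 0 1).
by have := sqr_ge0 (M 1 0); have := sqr_ge0 (M 0 0 + M 1 1); lra.
Qed.

(** One of the two columns carries at least half of the squared Frobenius norm, so a coordinate
    vector works. *)
Lemma fnorm_attained M : exists2 v, enorm v = 1 & fnorm M ^+ 2 <= 2 * enorm (M *m v) ^+ 2.
Proof.
pose e i : 'cV[R]_2 := delta_mx i 0.
have ee i : enorm (e i) = 1.
  apply/eqP; rewrite -(@eqrXn2 _ 2) ?enorm_ge0 // sqr_enorm !mxE expr1n.
  by elim/ord2_ind: i; rewrite /= ?mulr1n ?mulr0n expr1n expr0n ?addr0 ?add0r.
have eM i j : (M *m e i) j 0 = M j i.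
  by rewrite mul_cv2E !mxE; elim/ord2_ind: i; rewrite /= ?mulr1n ?mulr0n ?mulr1 ?mulr0 ?addr0 ?add0r.
have sE i : enorm (M *m e i) ^+ 2 = M 0 i ^+ 2 + M 1 i ^+ 2.
  by rewrite sqr_enorm !eM.
have [le|lt] := leP (M 0 0 ^+ 2 + M 1 0 ^+ 2) (M 0 1 ^+ 2 + M 1 1 ^+ 2).
  by exists (e 1); rewrite ?ee // sE sqr_fnorm; lra.
by exists (e 0); rewrite ?ee // sE sqr_fnorm; lra.
Qed.

Lemma fnorm_le2 M : exists2 v, enorm v = 1 & fnorm M <= 2 * enorm (M *m v).
Proof.
have [v v1 vM] := fnorm_attained M; exists v => //.
by have := enorm_ge0 (M *m v); have := fnorm_ge0 M; nra.
Qed.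

Lemma sl2_expanded M : \det M = 1 -> exists2 v, enorm v = 1 & 1 <= enorm (M *m v).
Proof.
move=> /sqr_fnorm_ge2 F2; have [v v1 vM] := fnorm_attained M; exists v => //.
by have := enorm_ge0 (M *m v); nra.
Qed.

Lemma operator_norm_le M : operator_norm M <= fnorm M.
Proof.
apply: ge_sup; last first.
  by move=> _ [v /= v1 <-]; have := enorm_mul M v; rewrite v1 mulr1.
by have [v v1 _] := fnorm_le2 M; exists (enorm (M *m v)), v.
Qed.

Lemma operator_norm_ge M : fnorm M <= 2 * operator_norm M.
Proof.
have [v v1 vM] := fnorm_le2 M; apply: le_trans vM _; rewrite ler_pM2l //.
apply: ub_le_sup; last by exists v.
exists (fnorm M) => _ [w /= w1 <-].
by have := enorm_mul M w; rewrite w1 mulr1.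
Qed.

Lemma enorm_mul_ge M v : \det M = 1 -> enorm v <= fnorm M * enorm (M *m v).
Proof.
move=> dM; have := enorm_mul (invmx M) (M *m v).
by rewrite mulmxA mulVmx ?sl2_unit // mul1mx fnorm_inv.
Qed.

Lemma fnorm_mul_ge_l M P : \det M = 1 -> fnorm P <= fnorm M * fnorm (M *m P).
Proof.
move=> dM; have := fnorm_mul (invmx M) (M *m P).
by rewrite mulmxA mulVmx ?sl2_unit // mul1mx fnorm_inv.
Qed.

Lemma fnorm_mul_ge_r M P : \det P = 1 -> fnorm M <= fnorm (M *m P) * fnorm P.
Proof.
move=> dP; have := fnorm_mul (M *m P) (invmx P).
by rewrite -mulmxA mulmxV ?sl2_unit // mulmx1 fnorm_inv.
Qed.

End PlaneMatrices.

(** * Hyperbolic products *)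

Section Hyperbolic.
Variable R : realType.
Implicit Types (D M : 'M[R]_2) (v w : 'cV[R]_2) (C x mu T : R).

Fixpoint bprod (g : nat -> 'M[R]_2) (q : nat) : 'M[R]_2 :=
  if q is q'.+1 then g q' *m bprod g q' else 1%:M.

(* Decompose D w along D v and its normal, where w is almost maximally expanded
   by M D: the normal component is small because D v has a short preimage. *)
Lemma avalanche_step M D x mu v :
  \det D = 1 -> 0 < x -> 0 <= mu -> fnorm D <= x -> fnorm M <= x ->
  2 * mu * x <= fnorm (M *m D) ->
  enorm v <= enorm (D *m v) ->
  mu * enorm (D *m v) <= enorm (M *m (D *m v)) + enorm v.
Proof.
move=> dD x0 mu0 Dx Mx MD; set y := D *m v => vy.
have [->|y0] := eqVneq y 0; first by rewrite enorm0 mulr0 addr_ge0 ?enorm_ge0.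
have yp : 0 < enorm y by rewrite enorm_gt0.
have [w w1 wMD] := fnorm_le2 (M *m D).
have {}wMD : mu * x <= enorm (M *m (D *m w)) by rewrite mulmxA; lra.
pose z := D *m w; pose yn : 'cV[R]_2 := \col_i (if i == 0 then - y 1 0 else y 0 0).
have zE : enorm y ^+ 2 *: z = vdot z y *: y + vwedge y z *: yn.
  by rewrite sqr_enorm /vdot /vwedge; apply: eq_cv2; rewrite !mxE /=; ring.
have ynE : enorm yn = enorm y.
  apply/eqP; rewrite -(@eqrXn2 _ 2) ?enorm_ge0 // !sqr_enorm !mxE /= sqrrN.
  by rewrite addrC.
have zx : enorm z <= x by apply: le_trans (enorm_mul D w) _; rewrite w1 mulr1.
(* As det D = 1, the area spanned by D v and D w is that of [v] and [w]. *)
have wd : `|vwedge y z| <= enorm v.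
  by rewrite vwedge_mul dD mul1r; have := vwedge_le v w; rewrite w1 mulr1.
have dt : `|vdot z y| <= x * enorm y.
  by apply: le_trans (vdot_le z y) _; rewrite ler_pM2r.
have key : enorm y ^+ 2 * enorm (M *m z) <=
    `|vdot z y| * enorm (M *m y) + `|vwedge y z| * enorm (M *m yn).
  rewrite -[enorm y ^+ 2]ger0_norm ?sqr_ge0 // -!enormZ scalemxAr.
  by rewrite zE mulmxDr -!scalemxAr enormD.
have Myn : enorm (M *m yn) <= x * enorm y.
  apply: le_trans (enorm_mul M yn) _; rewrite ynE.
  by rewrite ler_wpM2r // ltW.
have k1 : `|vdot z y| * enorm (M *m y) <= x * enorm y * enorm (M *m y).
  by rewrite ler_wpM2r ?enorm_ge0.
have k2 : `|vwedge y z| * enorm (M *m yn) <= enorm v * (x * enorm y).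
  by apply: ler_pM; rewrite ?enorm_ge0.
have k3 : enorm y ^+ 2 * (mu * x) <= enorm y ^+ 2 * enorm (M *m z).
  by rewrite ler_wpM2l ?sqr_ge0.
rewrite -(ler_pM2l (mulr_gt0 x0 yp)); move: k1 k2 k3 key; lra.
Qed.

(** Start from a unit vector that [g 0] does not shorten. Once a step does not contract,
    [avalanche_step] makes the next one expand by at least [mu - 1 >= 1], so its hypothesis renews
    itself. *)
Lemma avalanche (g : nat -> 'M[R]_2) x mu :
  (forall i, \det (g i) = 1) -> (forall i, fnorm (g i) <= x) ->
  (forall i, 2 * mu * x <= fnorm (g i.+1 *m g i)) -> 2 <= mu ->
  forall q, (mu - 1) ^+ q <= fnorm (bprod g q.+1).
Proof.
move=> dg gx gg mu2 q.
have x0 : 0 < x by apply: lt_le_trans (gx 0%N); have := fnorm_ge1 (dg 0%N); lra.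
have [v v1 gv] := sl2_expanded (dg 0%N).
pose z i := enorm (bprod g i *m v).
have step i : z i <= z i.+1 -> (mu - 1) * z i.+1 <= z i.+2.
  move=> zi; rewrite /z /= in zi *; rewrite -!mulmxA in zi *.
  have := avalanche_step (dg i) x0 _ (gx i) (gx i.+1) (gg i) zi.
  by move=> /(_ ltac:(lra)); rewrite mulrBl mul1r; lra.
have z0 i : 0 <= z i by exact: enorm_ge0.
have mono i : z i <= z i.+1.
  elim: i => [|i /step]; first by rewrite /z /= mulmx1 mul1mx v1.
  by apply: le_trans; have := z0 i.+1; nra.
have zq : (mu - 1) ^+ q <= z q.+1.
  elim: q => [|q IH]; first by rewrite expr0 /z /= mulmx1.
  rewrite exprS; apply: le_trans (step _ (mono _)); rewrite ler_wpM2l //; lra.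
by apply: le_trans zq _; have := enorm_mul (bprod g q.+1) v; rewrite v1 mulr1.
Qed.

Lemma det_bprod (g : nat -> 'M[R]_2) q : (forall i, \det (g i) = 1) -> \det (bprod g q) = 1.
Proof. by move=> dg; elim: q => [|q IH] /=; rewrite ?det1 // det_mulmx1. Qed.

(** The factor 2 covers the empty product, whose Frobenius norm is the square root of 2. *)
Lemma fnorm_bprod_le (g : nat -> 'M[R]_2) x q : 1 <= x ->
  (forall i, fnorm (g i) <= x) -> fnorm (bprod g q) <= 2 * x ^+ q.
Proof.
move=> x1 gx; elim: q => [|q IH] /=.
  rewrite expr0 mulr1; apply: ler_sqr0 => //.
  by rewrite sqr_fnorm !mxE /= mulr1n mulr0n; lra.
apply: le_trans (fnorm_mul _ _) _; rewrite exprS mulrCA.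
by apply: ler_pM; rewrite ?fnorm_ge0.
Qed.

(** Cayley-Hamilton gives D^(m+2) = (tr D) D^(m+1) - D^m; the induction carries the bound for two
    consecutive powers. *)
Lemma fnorm_expr_le D m : \det D = 1 ->
  fnorm (D ^+ m.+1) <= (`|\tr D| + 1) ^+ m * fnorm D.
Proof.
move=> dD; set T := `|\tr D|; have T0 : 0 <= T by exact: normr_ge0.
have F0 := fnorm_ge0 D.
suff [] : fnorm (D ^+ m.+1) <= (T + 1) ^+ m * fnorm D /\
  fnorm (D ^+ m) <= (T + 1) ^+ m * fnorm D by [].
have le1 k : (T + 1) ^+ k * fnorm D <= (T + 1) ^+ k.+1 * fnorm D.
  by rewrite ler_wpM2r // exprS ler_peMl ?exprn_ge0 //; lra.
elim: m => [|m [IH1 IH2]].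
  by rewrite expr1 expr0 mul1r; split => //; exact: fnorm1_le.
split; last exact: le_trans IH1 (le1 m).
have -> : D ^+ m.+2 = \tr D *: D ^+ m.+1 + (-1) *: D ^+ m.
  rewrite scaleN1r; apply/eqP; rewrite -subr_eq opprK; apply/eqP.
  by rewrite !exprS -!mulmxE sl2_cayley.
apply: le_trans (fnormD _ _) _; rewrite !fnormZ normrN1 mul1r -/T.
apply: (@le_trans _ _ (T * ((T + 1) ^+ m * fnorm D) + (T + 1) ^+ m * fnorm D)).
  by rewrite lerD // ler_wpM2l.
by rewrite [in leRHS]exprS; lra.
Qed.

Lemma convex_mono (z : nat -> R) : (forall j, 2 * z j.+1 <= z j.+2 + z j) ->
  z 0%N <= z 1%N -> forall i j, (i <= j)%N -> z i <= z j.
Proof.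
move=> zc z01; suff s j : z j <= z j.+1.
  by move=> i j /subnK <-; elim: (j - i)%N => // k /le_trans; apply; rewrite addSn.
by elim: j => // j; have := zc j; lra.
Qed.

Lemma orbit_convex D v j : \det D = 1 ->
  `|\tr D| * enorm (D ^+ j.+1 *m v) <= enorm (D ^+ j.+2 *m v) + enorm (D ^+ j *m v).
Proof.
move=> dD; rewrite -enormZ !exprS -!mulmxE -!mulmxA -sl2_cayley //.
exact: enormD.
Qed.

(** * Norms along the orbit of a matrix whose trace has modulus at least 2 *)

Section Orbit.
Variables (D : 'M[R]_2) (v : 'cV[R]_2) (m : nat).
Hypotheses (dD : \det D = 1) (T2 : 2 <= `|\tr D|) (m2 : (2 <= m)%N).
Let z j := enorm (D ^+ j *m v).

Let zT j : `|\tr D| * z j.+1 <= z j.+2 + z j.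
Proof. exact: orbit_convex. Qed.

Let z0 j : 0 <= z j. Proof. exact: enorm_ge0. Qed.

Let zmono : z 1%N <= z 2%N -> z 2%N <= z m.
Proof.
move=> z12; case: m m2 => [|[|k]] // _.
apply: (@convex_mono (fun j => z j.+1) _ z12 1%N k.+1) => // j.
by apply: le_trans (zT j.+1); rewrite ler_wpM2r.
Qed.

(** The norms [z j] are convex in [j], so growth from [z 1] to [z 2] would persist up to [z m].
    Hence [z 2 <= z 1], and the trace inequality at index 0 concludes. *)
Lemma orbit_contract : z m <= z 1%N -> (`|\tr D| - 1) * z 1%N <= z 0%N.
Proof.
move=> zm; have z2 : z 2%N <= z 1%N.
  by rewrite leNgt; apply/negP => lt21; have := zmono (ltW lt21); lra.
by have := zT 0; lra.
Qed.

(** Whether or not [z 1 <= z 2], one gets [z 2 <= z m]; Cayley-Hamilton then expresses [v] through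
    its first two images. *)
Lemma orbit_start : z 1%N < z m -> z 0%N <= (`|\tr D| + 1) * z m.
Proof.
move=> zm; have z2 : z 2%N <= z m.
  by have [/zmono//|lt21] := leP (z 1%N) (z 2%N); lra.
have : z 0%N <= z 2%N + `|\tr D| * z 1%N.
  rewrite /z expr0 expr1 mul1mx -[D ^+ 2]/(D *m D) -mulmxA.
  have /(canRL (addKr _)) {1}-> := sl2_cayley v dD.
  by apply: le_trans (enormD _ _) _; rewrite enormN enormZ.
have : `|\tr D| * z 1%N <= `|\tr D| * z m by rewrite ler_wpM2l // ltW.
by lra.
Qed.

End Orbit.

(** Plane vectors are coded as pairs to use the topology of [R * R]; the squared norms of their
    images are quadratic forms [q], hence continuous. *)
Lemma enorm_mul_closed (M P : 'M[R]_2) :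
  closed [set p : R * R | p.1 ^+ 2 + p.2 ^+ 2 = 1 /\
    enorm (M *m \col_i (if i == 0 then p.1 else p.2)) <=
    enorm (P *m \col_i (if i == 0 then p.1 else p.2))].
Proof.
pose q (a b c : R) (p : R * R) := a * (p.1 * p.1) + b * (p.1 * p.2) + c * (p.2 * p.2).
have qc a b c : continuous (q a b c).
  have f1 : continuous (fst : R * R -> R) by move=> x; exact: cvg_fst.
  have f2 : continuous (snd : R * R -> R) by move=> x; exact: cvg_snd.
  move=> p; rewrite /q.
  by apply: cvgD; [apply: cvgD|]; (apply: cvgM; first exact: cvg_cst);
    apply: cvgM; first [exact: f1 | exact: f2].
pose a (M : 'M[R]_2) := M 0 0 ^+ 2 + M 1 0 ^+ 2.
pose b (M : 'M[R]_2) := 2 * (M 0 0 * M 0 1 + M 1 0 * M 1 1).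
pose c (M : 'M[R]_2) := M 0 1 ^+ 2 + M 1 1 ^+ 2.
have eE (N : 'M[R]_2) p : enorm (N *m \col_i (if i == 0 then p.1 else p.2)) ^+ 2 =
    q (a N) (b N) (c N) p.
  by rewrite sqr_enorm !mul_cv2E !mxE /= /q /a /b /c; ring.
rewrite (_ : [set p | _] = q 1 0 1 @^-1` [set x | x = 1] `&`
  q (a M - a P) (b M - b P) (c M - c P) @^-1` [set x | x <= 0]).
  apply: closedI; apply: preimage_closed => [p _|].
  - exact: qc.
  - exact: closed_eq.
  - exact: qc.
  - exact: closed_le.
apply/seteqP; split=> p /= [p1 pM].
  split; first by rewrite /q; lra.
  have : enorm (M *m \col_i (if i == 0 then p.1 else p.2)) ^+ 2 <=
         enorm (P *m \col_i (if i == 0 then p.1 else p.2)) ^+ 2.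
    by rewrite ler_pXn2r ?nnegrE ?enorm_ge0.
  by rewrite !eE /q; lra.
split; first by move: p1; rewrite /q; lra.
by apply: ler_sqr0; rewrite ?enorm_ge0 // !eE; move: pM; rewrite /q; lra.
Qed.

(** Compactness: the vectors given for each [k] have a cluster point, and it satisfies every
    constraint, each being closed and met from some [k] on. *)
Lemma common_direction (M P : nat -> 'M[R]_2) :
  (forall k, exists2 v, enorm v = 1 &
     forall j, (j <= k)%N -> enorm (M j *m v) <= enorm (P j *m v)) ->
  exists2 v, enorm v = 1 & forall j, enorm (M j *m v) <= enorm (P j *m v).
Proof.
move=> /(_ _)/cid2-/all_sig2 [v v1 vMP].
pose B j := [set p : R * R | p.1 ^+ 2 + p.2 ^+ 2 = 1 /\
    enorm (M j *m \col_i (if i == 0 then p.1 else p.2)) <=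
    enorm (P j *m \col_i (if i == 0 then p.1 else p.2))].
pose f k : R * R := (v k 0 0, v k 1 0).
have vE k : \col_i (if i == 0 then (f k).1 else (f k).2) = v k.
  by apply: eq_cv2; rewrite mxE.
have fB j k : (j <= k)%N -> B j (f k).
  move=> jk; split; last by rewrite vE vMP.
  by rewrite -sqr_enorm v1 expr1n.
have ub (x y : R) : x ^+ 2 + y ^+ 2 = 1 -> -1 <= x <= 1.
  by move=> xy; have := sqr_ge0 y; nra.
have [p [_ pf]] : (`[-1, 1]%classic `*` `[-1, 1]%classic) `&` cluster (f @ \oo) !=set0.
  apply: (compact_setX (@segment_compact R (-1) 1) (@segment_compact R (-1) 1)).
  exists 0%N => // k _; have [f1 _] := fB 0%N k isT.
  split; rewrite /= in_itv /=; first exact: ub f1.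
  by rewrite addrC in f1; exact: ub f1.
have pB j : B j p.
  apply: (@enorm_mul_closed (M j) (P j)) => A pA; apply: (pf _ A) => //.
  by exists j => // k /= jk; exact: fB.
exists (\col_i (if i == 0 then p.1 else p.2)) => [|j]; last by have [] := pB j.
have [p1 _] := pB 0%N; apply/eqP; rewrite -(@eqrXn2 _ 2) ?enorm_ge0 //.
by rewrite sqr_enorm !mxE /= p1 expr1n.
Qed.

(* The set of directions not expanded from level k to level k + 1 is nonempty
   and, by the two orbit lemmas, decreases with k. *)
Lemma contracted_direction (X e : nat -> 'M[R]_2) (n : nat -> nat) C (tau : nat -> R) :
  (forall k, \det (X k) = 1) -> (forall k, \det (e k) = 1) ->
  (forall k, fnorm (e k) <= C) -> (forall k, (2 <= n k)%N) ->
  (forall k, X k.+1 = X k *m (e k *m X k) ^+ (n k).-1) ->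
  (forall k, 1 <= tau k) -> (forall k, tau k + 1 <= `|\tr (X k *m e k)|) ->
  (forall k, C ^+ 2 * (`|\tr (X k *m e k)| + 1) < tau k.+1) ->
  exists2 s, enorm s = 1 & forall k, enorm (X k *m s) <= C / tau k.
Proof.
move=> dX de eC n2 XS tau1 tautr trtau.
(* With this choice the powers 1 and [n k] of [D k] send [w k s] to [X k *m s] and [X k.+1 *m s], so
   the orbit lemmas compare two consecutive levels. *)
pose D k := X k *m e k; pose w k (s : 'cV[R]_2) := invmx (e k) *m s.
have dD k : \det (D k) = 1 by exact: det_mulmx1.
have T2 k : 2 <= `|\tr (D k)| by have := tau1 k; have := tautr k; rewrite /D; lra.
have z0 k s : enorm (D k ^+ 0 *m w k s) <= C * enorm s.
  rewrite expr0 mul1mx; apply: le_trans (enorm_mul _ _) _.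
  by rewrite fnorm_inv // ler_wpM2r ?enorm_ge0.
have z0' k s : enorm s <= C * enorm (D k ^+ 0 *m w k s).
  rewrite expr0 mul1mx; have := enorm_mul (e k) (w k s).
  rewrite mulmxA mulmxV ?sl2_unit // mul1mx => /le_trans; apply.
  by rewrite ler_wpM2r ?enorm_ge0.
have z1 k s : D k ^+ 1 *m w k s = X k *m s.
  by rewrite expr1 /D /w !mulmxA -(mulmxA (X k)) mulmxV ?sl2_unit // mulmx1.
have zn k s : D k ^+ n k *m w k s = X k.+1 *m s.
  rewrite XS -(prednK (ltnW (n2 k))) -mulmx_expr_swap exprSr -mulmxE /w !mulmxA.
  by rewrite -(mulmxA _ (e k)) mulmxV ?sl2_unit // mulmx1.
have C0 : 0 <= C by apply: le_trans (eC 0%N); exact: fnorm_ge0.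
have contract k s : enorm s = 1 -> enorm (X k.+1 *m s) <= enorm (X k *m s) ->
    enorm (X k *m s) <= C / tau k.
  rewrite -!zn -z1 => s1 /(orbit_contract (dD k) (T2 k) (n2 k)) le0.
  have := z0 k s; rewrite s1 mulr1 => le1; have t0 := tau1 k.
  rewrite ler_pdivlMr; last by lra.
  have := tautr k; rewrite -/(D k) => le2.
  have := enorm_ge0 (D k ^+ 1 *m w k s); nra.
(* Otherwise [orbit_start] bounds |X_(k+1) s| below by 1 / (C (T + 1)), with T = |tr D_k|, while
   [contract] bounds it above by [C / tau k.+1]; this contradicts [trtau]. *)
have nested k s : enorm s = 1 -> enorm (X k.+2 *m s) <= enorm (X k.+1 *m s) ->
    enorm (X k.+1 *m s) <= enorm (X k *m s).
  move=> s1 /(contract _ _ s1) le1; rewrite leNgt; apply/negP => lt1.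
  have := @orbit_start (D k) (w k s) (n k) (dD k) (T2 k) (n2 k).
  rewrite z1 zn => /(_ lt1) le2.
  have := z0' k s; rewrite s1 => le3.
  have t1 := tau1 k.+1; have lt2 := trtau k.
  move: le1; rewrite ler_pdivlMr; last by lra.
  move: le2 le3 lt2; rewrite -/(D k).
  set T := `|_|; set y := enorm (X k.+1 *m s); set z := enorm (_ *m w k s).
  have T0 : 0 <= T by exact: normr_ge0.
  move=> le2 le3 lt2 le1.
  have le4 : 1 <= C * ((T + 1) * y) by apply: le_trans le3 _; rewrite ler_wpM2l.
  have le5 : C * (T + 1) * (y * tau k.+1) <= C * (T + 1) * C.
    by rewrite ler_wpM2l // mulr_ge0 //; lra.
  nra.
have [|s s1 sX] := common_direction (M := fun k => X k.+1) (P := X).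
  move=> k.
  (* Take [y] not shortened by X_k X_(k+1)^-1, pull it back by X_(k+1) and normalise. *)
  have [s s1 sk] : exists2 s, enorm s = 1 & enorm (X k.+1 *m s) <= enorm (X k *m s).
    have dY : \det (X k *m invmx (X k.+1)) = 1 by rewrite det_mulmx1 ?det_invmx1.
    have [y y1 yX] := sl2_expanded dY.
    pose s := invmx (X k.+1) *m y.
    have s0 : 0 < enorm s.
      rewrite enorm_gt0; apply/eqP => s0; move: yX.
      by rewrite -mulmxA -/s s0 mulmx0 enorm0; lra.
    exists ((enorm s)^-1 *: s).
      by rewrite enormZ gtr0_norm ?invr_gt0 // mulVf // gt_eqF.
    have Xs : X k.+1 *m s = y by rewrite /s mulmxA mulmxV ?mul1mx ?sl2_unit.
    by rewrite -!scalemxAr !enormZ ler_wpM2l ?normr_ge0 // Xs y1 mulmxA.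
  (* Descend from level [k] by [nested]; for [i >= k] the truncated difference stays 0. *)
  exists s => // j jk; have : forall i, enorm (X (k - i).+1 *m s) <= enorm (X (k - i)%N *m s).
    elim=> [|i IH]; first by rewrite subn0.
    have [ik|ki] := ltnP i k; last first.
      by have -> : (k - i.+1 = k - i)%N by lia.
    by apply: nested => //; move: IH; rewrite -subnSK.
  by move/(_ (k - j)%N); rewrite subKn.
by exists s => // k; exact: contract.
Qed.
End Hyperbolic.

(** * Products along the Toeplitz recursion *)

Section ToeplitzProducts.
Variable R : realType.
Implicit Types (x y : R).

Lemma fnorm_mul_expr (P M : 'M[R]_2) m :
  fnorm (P *m M ^+ m) <= fnorm P * fnorm M ^+ m.
Proof.
elim: m => [|m IH]; first by rewrite !expr0 mulmx1 mulr1.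
rewrite !exprSr -mulmxE mulmxA mulrA; apply: le_trans (fnorm_mul _ _) _.
by rewrite ler_wpM2r ?fnorm_ge0.
Qed.

Lemma ln_le_mono x y : 0 < x -> x <= y -> ln x <= ln y.
Proof. by move=> x0 xy; rewrite ler_ln // posrE // (lt_le_trans x0). Qed.

Lemma expR_le_ln x y : 0 < y -> x <= ln y -> expR x <= y.
Proof. by move=> y0 xy; rewrite -[leRHS]lnK ?posrE // ler_expR. Qed.

Lemma ln_le_expR x y : 0 < y -> ln y <= x -> y <= expR x.
Proof. by move=> y0 xy; rewrite -[leLHS]lnK ?posrE // ler_expR. Qed.

Lemma expR_gt x : x < expR x.
Proof. by have := expR_ge1Dx x; lra. Qed.

Lemma vwedge_eq0 (v w : 'cV[R]_2) : enorm w = 1 -> vwedge v w = 0 ->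
  v = vdot v w *: w.
Proof.
rewrite /vwedge /vdot => w1 vw; have := sqr_enorm w; rewrite w1 expr1n => ww.
apply: eq_cv2; rewrite mxE.
  by have := congr1 ( *%R (w 1 0)) vw; have := congr1 ( *%R (v 0 0)) ww; lra.
by have := congr1 ( *%R (w 0 0)) vw; have := congr1 ( *%R (v 1 0)) ww; lra.
Qed.

Variables (I : Type) (a : nat -> I) (n ell : nat -> nat).
Variables (E : I -> 'M[R]_2) (X : nat -> 'M[R]_2) (C : R).
Hypotheses (n2 : forall k, (2 <= n k)%N) (ell0 : (0 < ell 0)%N).
Hypothesis (ellS : forall k, ell k.+1 = (n k * ell k)%N).
Hypotheses (dE : forall c, \det (E c) = 1) (dX0 : \det (X 0) = 1).
Hypothesis (EC : forall c, fnorm (E c) <= C).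
Hypothesis (XS : forall k, X k.+1 = X k *m (E (a k) *m X k) ^+ (n k).-1).

Let L k : R := (ell k)%:R.

Let dX k : \det (X k) = 1.
Proof. by elim: k => // k IH; rewrite XS det_mulmx1 // det_expmx1 // det_mulmx1. Qed.

Let C1 : 1 <= C.
Proof. exact: le_trans (fnorm_ge1 (dE (a 0))) (EC _). Qed.

Let Cp : 0 < C. Proof. exact: lt_le_trans C1. Qed.

Let ell_gt k : (k < ell k)%N.
Proof.
elim: k => // k IH; rewrite ellS.
by have := n2 k; nia.
Qed.

Let L_gt0 k : 0 < L k. Proof. by rewrite ltr0n (leq_ltn_trans _ (ell_gt k)). Qed.

Let L_infty x : \forall k \near \oo, x <= L k.
Proof.
near=> k; apply: (@le_trans _ _ k%:R); last by rewrite ler_nat ltnW.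
by near: k; exact: nbhs_infty_ger.
Unshelve. all: by end_near. Qed.

Let LS k : L k.+1 = (n k)%:R * L k.
Proof. by rewrite /L ellS natrM. Qed.

Let X_gt0 k : 0 < fnorm (X k).
Proof. by have := fnorm_ge1 (dX k); lra. Qed.

(** Submultiplicativity along [XS] makes (ln |X_k| + ln C) / ell k nonincreasing, the summand ln C
    paying for the letter matrices. [Lam] is its limit, hence a lower bound at every [k]. *)
Lemma growth_rate : exists Lam : R,
  [/\ 0 <= Lam, forall k, Lam * L k <= ln (fnorm (X k)) + ln C &
   forall eps, 0 < eps -> \forall k \near \oo,
     ln (fnorm (X k)) + ln C <= (Lam + eps) * L k].
Proof.
pose b k := (ln (fnorm (X k)) + ln C) / L k.
have lnC : 0 <= ln C by exact: ln_ge0.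
have b0 k : 0 <= b k by rewrite divr_ge0 ?addr_ge0 ?ln_ge0 ?fnorm_ge1 // ltW.
have bS k : b k.+1 <= b k.
  rewrite /b ler_pdivlMr // mulrAC ler_pdivrMr // LS mulrA ler_pM2r //.
  have le1 : fnorm (X k.+1) <= fnorm (X k) * (C * fnorm (X k)) ^+ (n k).-1.
    rewrite XS; apply: le_trans (fnorm_mul_expr _ _ _) _.
    rewrite ler_wpM2l ?fnorm_ge0 //; apply: lerXn2r; rewrite ?nnegrE ?fnorm_ge0 //.
      by rewrite mulr_ge0 ?fnorm_ge0 // (le_trans ler01).
    apply: le_trans (fnorm_mul _ _) _.
    by rewrite ler_wpM2r ?fnorm_ge0.
  have /ln_le_mono := le1 => /(_ (X_gt0 _)).
  have CX : 0 < C * fnorm (X k) by rewrite mulr_gt0.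
  rewrite lnM ?posrE ?exprn_gt0 // lnXn // lnM ?posrE //.
  have -> : (n k)%:R = (n k).-1%:R + 1 :> R.
    by rewrite natr1 prednK // (leq_trans _ (n2 k)).
  by rewrite -mulr_natr; lra.
have /nonincreasing_seqP bmono := bS.
have bcvg : cvgn b.
  apply: nonincreasing_is_cvgn => //; exists 0 => _ [k _ <-]; exact: b0.
exists (limn b); split=> [|k|eps eps0].
- by apply: limr_ge => //; exists 0%N => // k _; exact: b0.
- by rewrite -ler_pdivlMr //; exact: nonincreasing_cvgn_ge.
near=> k; rewrite -ler_pdivrMr // ltW //.
by near: k; apply: (cvgr_lt (limn b)); rewrite ?ltrDl.
Unshelve. all: by end_near. Qed.

(** * No cancellation between blocks when the exponent is positive *)

Section Positive.
Variable Lam : R.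
Hypotheses (Lam_gt0 : 0 < Lam) (LamX : forall k, Lam * L k <= ln (fnorm (X k)) + ln C).
Hypothesis (XLam : forall eps, 0 < eps -> \forall k \near \oo,
     ln (fnorm (X k)) + ln C <= (Lam + eps) * L k).

Let dXE k c : \det (X k *m E c) = 1.
Proof. exact: det_mulmx1. Qed.

(** With E = E_(a_k), X_(k+1) E is (X_k E)^(n_k), whose norm is at most (T + 1)^(n_k - 1) |X_k E| by
    [fnorm_expr_le]. As X_(k+1) grows at rate [Lam], the trace must be large. *)
Lemma trace_growth eps : 0 < eps <= Lam -> \forall k \near \oo,
  expR ((Lam - eps) * L k) + 1 <= `|\tr (X k *m E (a k))|.
Proof.
move=> /andP[eps0 epsL]; have lnC : 0 <= ln C by exact: ln_ge0.
near=> k.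
set D := X k *m E (a k); set T := `|\tr D|.
have T0 : 0 <= T by exact: normr_ge0.
have nk : n k = (n k).-1.+1 by rewrite prednK // (leq_trans _ (n2 k)).
have le1 : fnorm (X k.+1) <= (T + 1) ^+ (n k).-1 * (fnorm (X k) * C * C).
  rewrite XS; apply: le_trans (fnorm_mul_ge_r _ (dE (a k))) _.
  rewrite -mulmx_expr_swap -mulmxA mulmxE -exprSr mulrA; apply: ler_pM; rewrite ?fnorm_ge0 //.
  apply: le_trans (fnorm_expr_le _ (dXE k (a k))) _.
  rewrite ler_wpM2l ?exprn_ge0 ?addr_ge0 //.
  apply: le_trans (fnorm_mul _ _) _.
  by rewrite ler_wpM2l ?fnorm_ge0.
have T1 : 0 < T + 1 by lra.
have /ln_le_mono := le1 => /(_ (X_gt0 _)).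
rewrite lnM ?posrE ?exprn_gt0 ?mulr_gt0 // lnXn //.
rewrite !lnM ?posrE ?mulr_gt0 // -mulr_natr => le2.
have le3 := LamX k.+1; rewrite LS nk -natr1 in le3.
have le4 : ln (fnorm (X k)) + ln C <= (Lam + eps / 2) * L k.
  by near: k; apply: XLam; lra.
have m1 : 1 <= (n k).-1%:R :> R by rewrite ler1n -ltnS -nk.
have Lk := L_gt0 k.
have le5 : (n k).-1%:R * (Lam * L k - eps / 2 * L k - 2 * ln C) <=
    (n k).-1%:R * ln (T + 1).
  (* As [n k - 1 >= 1], the error terms may be multiplied by it too, and then it cancels. *)
  have : 0 <= ((n k).-1%:R - 1) * (eps / 2 * L k + 2 * ln C).
    apply: mulr_ge0; first by lra.
    by apply: addr_ge0; apply: mulr_ge0 => //; lra.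
  by lra.
move: le5; rewrite ler_pM2l; last by lra.
move=> /expR_le_ln => /(_ T1) le6.
have e1 : 1 <= expR ((Lam - eps) * L k).
  by rewrite -expR0 ler_expR; apply: mulr_ge0; have := L_gt0 k; lra.
(* The factor 3 pays for the two summands 1, in [T + 1] and in the claim. *)
have : 3 * expR ((Lam - eps) * L k) <= expR (Lam * L k - eps / 2 * L k - 2 * ln C).
  have -> : Lam * L k - eps / 2 * L k - 2 * ln C =
    (eps / 2 * L k - 2 * ln C) + (Lam - eps) * L k by lra.
  rewrite expRD ler_wpM2r ?expR_ge0 //.
  suff : 2 <= eps / 2 * L k - 2 * ln C.
    by have := expR_ge1Dx (eps / 2 * L k - 2 * ln C); lra.
  have : (2 + 2 * ln C) / (eps / 2) <= L k by near: k; exact: L_infty.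
  by rewrite ler_pdivrMr; [lra | lra].
lra.
Unshelve. all: by end_near. Qed.

Lemma trace_upper eps : 0 < eps -> \forall k \near \oo,
  `|\tr (X k *m E (a k))| <= 2 * expR ((Lam + eps) * L k).
Proof.
move=> eps0; near=> k; apply: le_trans (tr_le_fnorm _) _; rewrite ler_pM2l //.
apply: le_trans (fnorm_mul _ _) _.
apply: (@le_trans _ _ (fnorm (X k) * C)); first by rewrite ler_wpM2l ?fnorm_ge0.
apply: ln_le_expR; first by rewrite mulr_gt0.
by rewrite lnM ?posrE //; near: k; exact: XLam.
Unshelve. all: by end_near. Qed.

(** X_k preserves area, so |X_k E_c u| |X_k s| is at least the fixed positive area of E_c u and s.
    Here X_k s is short, and X_k E_c u is the image of the short vector X_k^-1 u under X_k E_c X_k,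
    which must therefore be large. *)
Lemma pair_growth c eps : 0 < eps ->
  (forall N, exists2 k, (N <= k)%N & a k = c) ->
  \forall k \near \oo, expR ((2 * Lam - eps) * L k) <= fnorm (X k *m E c *m X k).
Proof.
move=> eps0 ac.
(* An eighth keeps the exponents [Lam - 3 * eta] and [eps - 2 * eta] used below positive. *)
pose eta := Num.min eps Lam / 8.
have [eta0 eta_eps eta_Lam] : [/\ 0 < eta, 8 * eta <= eps & 8 * eta <= Lam].
  have m0 : 0 < Num.min eps Lam by rewrite lt_min eps0.
  have m1 : Num.min eps Lam <= eps by rewrite ge_min lexx.
  have m2 : Num.min eps Lam <= Lam by rewrite ge_min lexx orbT.
  by rewrite /eta; split; lra.
pose tau k := expR ((Lam - eta) * L k).
have [K _ HK] : \forall k \near \oo, tau k + 1 <= `|\tr (X k *m E (a k))| /\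
    C ^+ 2 * (`|\tr (X k *m E (a k))| + 1) < tau k.+1.
  near=> k; split.
    by near: k; apply: trace_growth; lra.
  have : `|\tr (X k *m E (a k))| <= 2 * expR ((Lam + eta) * L k).
    by near: k; exact: trace_upper.
  have e1 : 1 <= expR ((Lam + eta) * L k).
    by rewrite -expR0 ler_expR; apply: mulr_ge0; have := L_gt0 k; lra.
  (* As [n k >= 2], [tau k.+1] is at least the square of [tau k], split here into the growth of the
     trace bound and a factor that beats the constants. *)
  have : expR ((Lam - 3 * eta) * L k) * expR ((Lam + eta) * L k) <= tau k.+1.
    rewrite -expRD ler_expR LS.
    have : 0 <= ((n k)%:R - 2) * ((Lam - eta) * L k).
      rewrite mulr_ge0 ?subr_ge0 ?ler_nat ?n2 //.
      by apply: mulr_ge0; have := L_gt0 k; lra.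
    lra.
  have : C ^+ 2 * 3 < expR ((Lam - 3 * eta) * L k).
    apply: le_lt_trans (expR_gt _); rewrite [leRHS]mulrC -ler_pdivrMr //.
      by near: k; exact: L_infty.
    by lra.
  have C2 : 0 < C ^+ 2 by rewrite exprn_gt0.
  set e := expR _; set f := expR _ in e1 *; set t := `|_|.
  by nra.
have HK' k := HK (K + k)%N (leq_addr k K).
have tau1 k : 1 <= tau k.
  by rewrite -expR0 ler_expR; apply: mulr_ge0; have := L_gt0 k; lra.
have tau_infty x : \forall k \near \oo, x <= tau k.
  near=> k; apply: le_trans (ltW (expR_gt _)).
  rewrite [leRHS]mulrC -ler_pdivrMr; last by lra.
  by near: k; exact: L_infty.
have [s s1 sX] : exists2 s, enorm s = 1 &
    forall k, enorm (X (K + k)%N *m s) <= C / tau (K + k)%N.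
  apply: (@contracted_direction _ _ (fun k => E (a (K + k)%N))
    (fun k => n (K + k)%N)) => // k; rewrite ?addnS //; by have [] := HK' k.
(* The inverses obey the same recursion, with letter matrices [invmx (E c)] and unchanged traces. *)
have [u u1 uX] : exists2 u, enorm u = 1 &
    forall k, enorm (invmx (X (K + k)%N) *m u) <= C / tau (K + k)%N.
  have trV k : \tr (invmx (X k) *m invmx (E (a k))) = \tr (X k *m E (a k)).
    rewrite -invmxM // mxtrace_mulC sl2_inv ?det_mulmx1 //.
    by rewrite !tr_mx2E !adj2E addrC.
  apply: (@contracted_direction _ _ (fun k => invmx (E (a (K + k)%N)))
    (fun k => n (K + k)%N)) => // k; rewrite ?trV ?det_invmx1 ?fnorm_inv ?addnS //.
  - rewrite XS invmxM ?det_expmx1 ?det_mulmx1 //.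
    by rewrite invmx_expr ?det_mulmx1 // invmxM // mulmx_expr_swap.
  - by have [] := HK' k.
  - by have [] := HK' k.
have {}sX k : (K <= k)%N -> enorm (X k *m s) <= C / tau k.
  by move=> Kk; have := sX (k - K)%N; rewrite subnKC.
have {}uX k : (K <= k)%N -> enorm (invmx (X k) *m u) <= C / tau k.
  by move=> Kk; have := uX (k - K)%N; rewrite subnKC.
(* Suppose y = E_c u is a multiple of s; put D = E_c X_k and w = X_k^-1 u, so that D w = y. In D y +
   w = (tr D) y the left side is of order 1 / tau k, against |tr D| >= tau k + 1 when a_k = c. *)
have us : vwedge (E c *m u) s != 0.
  apply/eqP => /(vwedge_eq0 s1); set y := E c *m u; set lam := vdot _ _ => yE.
  have ylam : enorm y = `|lam| by rewrite yE enormZ s1 mulr1.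
  have y_ge : 1 <= C * enorm y.
    rewrite -u1; apply: le_trans (enorm_mul_ge _ (dE c)) _.
    by rewrite ler_wpM2r ?enorm_ge0.
  have [N _ NP] := tau_infty (2 * C ^+ 2).
  have [k kN ak] := ac (N + K)%N.
  have := NP k (leq_trans (leq_addr _ _) kN).
  have Kk := leq_trans (leq_addl N K) kN.
  have := sX k Kk; have := uX k Kk.
  have [] := HK k Kk; rewrite ak.
  set w := invmx (X k) *m u => tr1 _ wle sle taule.
  have dD : \det (E c *m X k) = 1 by exact: det_mulmx1.
  have Dw : E c *m X k *m w = y.
    by rewrite /w /y mulmxA -(mulmxA (E c)) mulmxV ?mulmx1 ?sl2_unit.
  have := sl2_cayley w dD; rewrite Dw mxtrace_mulC => /(congr1 (@euclidean_norm R)).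
  rewrite enormZ => ch.
  have le1 := enormD (E c *m X k *m y) w; rewrite ch in le1.
  have le2 : enorm (E c *m X k *m y) <= enorm y * (C * (C / tau k)).
    rewrite [in leLHS]yE -scalemxAr enormZ -ylam ler_wpM2l ?enorm_ge0 //.
    rewrite -mulmxA; apply: le_trans (enorm_mul _ _) _.
    by apply: ler_pM; rewrite ?fnorm_ge0 ?enorm_ge0.
  have t0 : 0 < tau k by exact: expR_gt0.
  have le3 : C / tau k <= C * (C * enorm y) / tau k.
    by rewrite ler_pM2r ?invr_gt0 // ler_peMr // ltW.
  have y0 : 0 < enorm y.
    by have := enorm_ge0 y; rewrite le_eqVlt => /predU1P[y0|//]; move: y_ge; rewrite -y0 mulr0; lra.
  have le4 : tau k * enorm y < enorm y * (2 * C ^+ 2 / tau k).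
    have : (tau k + 1) * enorm y <= `|\tr (X k *m E c)| * enorm y.
      by rewrite ler_wpM2r ?enorm_ge0.
    have : enorm y * (2 * C ^+ 2 / tau k) = enorm y * (C * (C / tau k)) + C * (C * enorm y) / tau k.
      by ring.
    by lra.
  have : 2 * C ^+ 2 / tau k <= 1 by rewrite ler_pdivrMr // mul1r.
  by have := tau1 k; nra.
pose del := `|vwedge (E c *m u) s|.
have del0 : 0 < del by rewrite normr_gt0.
near=> k.
have Kk : (K <= k)%N by near: k; exists K.
have t0 : 0 < tau k by exact: expR_gt0.
have le1 : del <= fnorm (X k *m E c *m X k) * (C / tau k) * (C / tau k).
  rewrite /del -[vwedge _ _]mul1r -(dX k) -vwedge_mul.
  apply: le_trans (vwedge_le _ _) _; apply: ler_pM; rewrite ?enorm_ge0 ?sX //.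
  have -> : X k *m (E c *m u) = X k *m E c *m X k *m (invmx (X k) *m u).
    by rewrite -!mulmxA mulKVmx ?sl2_unit.
  apply: le_trans (enorm_mul _ _) _.
  by rewrite ler_wpM2l ?fnorm_ge0 ?uX.
have le2 : expR ((2 * Lam - eps) * L k) * (C ^+ 2) <= del * tau k ^+ 2.
  set A := expR ((eps - 2 * eta) * L k).
  have -> : tau k ^+ 2 = expR ((2 * Lam - eps) * L k) * A.
    by rewrite expr2 -!expRD; congr expR; ring.
  rewrite [leRHS]mulrCA ler_wpM2l ?expR_ge0 // [leRHS]mulrC -ler_pdivrMr //.
  apply: le_trans (ltW (expR_gt _)); rewrite [leRHS]mulrC -ler_pdivrMr; last by lra.
  by near: k; exact: L_infty.
move: le1; have -> : fnorm (X k *m E c *m X k) * (C / tau k) * (C / tau k) =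
  fnorm (X k *m E c *m X k) * C ^+ 2 / tau k ^+ 2.
  by field; rewrite gt_eqF.
rewrite ler_pdivlMr ?exprn_gt0 // => le1.
by rewrite -(ler_pM2r (exprn_gt0 2 Cp)); exact: le_trans le2 le1.
Unshelve. all: by end_near. Qed.
End Positive.
End ToeplitzProducts.

(** * Combinatorics of simple Toeplitz words *)

Section ToeplitzCombinatorics.
Variables (Alph : finType) (a : nat -> Alph) (n : nat -> nat).
Hypothesis (n2 : forall k, (2 <= n k)%N).

Definition ell (k : nat) : nat := \prod_(i < k) n i.

Lemma ellS k : ell k.+1 = (n k * ell k)%N.
Proof. by rewrite /ell big_ord_recr mulnC. Qed.

Lemma ell_gt k : (k < ell k)%N.
Proof.
elim: k => [|k IH]; first by rewrite /ell big_ord0.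
by rewrite ellS; have := n2 k; nia.
Qed.

Lemma ell_gt0 k : (0 < ell k)%N.
Proof. exact: leq_ltn_trans (ell_gt k). Qed.

Lemma dvd_ell j k : (j <= k)%N -> (ell j %| ell k)%N.
Proof.
by move=> /subnK <-; elim: (k - j)%N => // i IH; rewrite addSn ellS dvdn_mull.
Qed.

Lemma leq_ell j k : (j <= k)%N -> (ell j <= ell k)%N.
Proof. by move=> jk; rewrite dvdn_leq ?ell_gt0 ?dvd_ell. Qed.

Lemma ell_ltS k : (ell k < ell k.+1)%N.
Proof. by rewrite ellS; have := n2 k; have := ell_gt0 k; nia. Qed.

(** For [q > 0] the range [j <= q] misses nothing because [ell j > j]; at 0 the value is a default,
    0. *)
Definition level (q : nat) : nat := \max_(j < q.+1 | (ell j %| q)%N) j.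

Lemma dvd_level q j : (0 < q)%N -> (ell j %| q)%N = (j <= level q)%N.
Proof.
move=> q0; apply/idP/idP => [jq|].
  have jltq : (j < q.+1)%N.
    by rewrite ltnS (leq_trans (ltnW (ell_gt j))) // dvdn_leq.
  exact: (@leq_bigmax_cond _ _ (fun i : 'I_q.+1 => nat_of_ord i) (Ordinal jltq)).
have : (0 < #|[pred i : 'I_q.+1 | (ell i %| q)%N]|)%N.
  by apply/card_gt0P; exists ord0; rewrite inE /ell big_ord0 dvd1n.
move=> /(eq_bigmax_cond (fun i : 'I_q.+1 => nat_of_ord i)) [i].
rewrite inE /level => iq -> ji; exact: dvdn_trans (dvd_ell ji) iq.
Qed.

Lemma level_uniq q m : (0 < q)%N -> (ell m %| q)%N -> ~~ (ell m.+1 %| q)%N ->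
  level q = m.
Proof.
move=> q0; rewrite !dvd_level // -ltnNge ltnS => le1 le2.
by apply/eqP; rewrite eqn_leq le1 le2.
Qed.

Lemma level_eq q q' : (0 < q)%N -> (0 < q')%N ->
  (forall j, (ell j %| q)%N = (ell j %| q')%N) -> level q = level q'.
Proof.
move=> q0 q0' e; apply: level_uniq => //; first by rewrite e dvd_level.
by rewrite e dvd_level // ltnn.
Qed.

Lemma dvdn_absDr d (x i : int) : (d %| `|x|)%N -> (d %| `|(x + i)%R|)%N = (d %| `|i|)%N.
Proof.
by move=> dx; have /rpredDl := (dx : x \in dvdz d%:Z); apply.
Qed.

(** Divisibility by [ell j] is unchanged for [j <= k], and fails on both sides for larger [j]
    because [ell k] divides [ell j]. *)
Lemma level_period k (x i : int) : (ell k %| `|x|)%N -> ~~ (ell k %| `|i|)%N ->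
  level `|(x + i)%R|%N = level `|i|%N.
Proof.
move=> kx ki.
have kxi : ~~ (ell k %| `|(x + i)%R|)%N by rewrite dvdn_absDr.
apply: level_eq => [||j].
- by rewrite lt0n; apply: contra kxi => /eqP ->.
- by rewrite lt0n; apply: contra ki => /eqP ->.
have [jk|/ltnW kj] := leqP j k.
  by rewrite dvdn_absDr // (dvdn_trans (dvd_ell jk) kx).
by rewrite (contraNF (dvdn_trans (dvd_ell kj)) kxi) (contraNF (dvdn_trans (dvd_ell kj)) ki).
Qed.

Lemma level_ell k : level (ell k) = k.
Proof.
by apply: level_uniq; rewrite ?ell_gt0 // gtnNdvd ?ell_gt0 ?ell_ltS.
Qed.

(** Counting positions from 1, the letter added after m + 1 copies sits at (m + 1) ell k with m + 1
    < n_k, hence has level k; the copy behind it repeats the levels of the first by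
    [level_period]. *)
Lemma toeplitz_wordE k :
  toeplitz_word a n k = mkseq (fun i => a (level i.+1)) (ell k).-1.
Proof.
elim: k => [|k IH]; first by rewrite /ell big_ord0.
suff rep m : (m < n k)%N -> toeplitz_word a n k ++
    flatten (nseq m (a k :: toeplitz_word a n k)) =
    mkseq (fun i => a (level i.+1)) (m.+1 * ell k).-1.
  have nk : (n k).-1.+1 = n k by rewrite prednK // (leq_trans _ (n2 k)).
  by rewrite ellS -[in RHS]nk -rep ?nk.
elim: m => [|m IHm] mn; first by rewrite /= cats0 mul1n.
rewrite -addn1 nseqD flatten_cat catA IHm ?(ltnW mn) //= cats0 addn1.
have -> : (m.+2 * ell k).-1 = ((m.+1 * ell k).-1 + ell k)%N.
  by have := ell_gt0 k; nia.
rewrite /mkseq iotaD map_cat; congr (_ ++ _); rewrite add0n.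
have ek : ell k = (ell k).-1.+1 by rewrite prednK // ell_gt0.
have mk : (m.+1 * ell k).-1.+1 = (m.+1 * ell k)%N.
  by rewrite prednK // muln_gt0 ell_gt0.
rewrite [X in iota _ X]ek /= mk; congr (a _ :: _).
  apply/esym/level_uniq; [by rewrite muln_gt0 ell_gt0 | exact: dvdn_mull |].
  by rewrite ellS dvdn_pmul2r ?ell_gt0 // gtnNdvd.
rewrite IH /mkseq -[(m.+1 * ell k)%N]addn0 iotaDl -map_comp.
apply/eq_in_map => i; rewrite mem_iota add0n /= => ik; congr (a _).
rewrite -addnS; apply/esym/(@level_period k (m.+1 * ell k)%N%:Z i.+1).
  by rewrite absz_nat dvdn_mull.
by rewrite absz_nat gtnNdvd // ek.
Qed.

Lemma toeplitz_limitE i : toeplitz_limit a n i = a (level i.+1).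
Proof.
rewrite /toeplitz_limit toeplitz_wordE nth_mkseq //.
by have := ell_gt i.+1; lia.
Qed.

Lemma mkseq_eq (T : Type) (f g : nat -> T) m :
  mkseq f m = mkseq g m <-> forall i, (i < m)%N -> f i = g i.
Proof.
split=> [fg i im|fg]; last by apply/eq_in_map => i; rewrite mem_iota => /fg.
by have := congr1 (fun s => nth (f i) s i) fg; rewrite !nth_mkseq.
Qed.

(* the two-sided word ... p^(k) c p^(k) ... with the letter c at position 0 *)
Definition lead (c : Alph) (i : int) : Alph := if i == 0 then c else a (level `|i|%N).

Lemma lead0 c : lead c 0 = c. Proof. by []. Qed.

Lemma lead_center c k (x i : int) : (ell k %| `|x|)%N -> (`|i| < ell k)%N ->
  lead c (x + i) = lead (lead c x) i.
Proof.
move=> kx ik; rewrite /lead; have [->|i0] := eqVneq i 0; first by rewrite addr0.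
have ki : ~~ (ell k %| `|i|)%N by rewrite gtnNdvd // lt0n absz_eq0.
rewrite (level_period kx ki) ifF //; apply/negP => /eqP xi.
by move: ki; rewrite -(dvdn_absDr i kx) xi dvdn0.
Qed.

Definition recurrent (c : Alph) := forall N, exists2 k, (N <= k)%N & a k = c.

Lemma recurrentP c : reflect (recurrent c) (c \in eventual_alphabet a).
Proof. by rewrite inE; apply: asboolP. Qed.

(** Each letter that is not recurrent is absent from some index on, and the alphabet is finite. *)
Lemma eventually_recurrent : exists K, forall k, (K <= k)%N -> recurrent (a k).
Proof.
have /choice [N NP] : forall c : Alph, exists N, forall k, (N <= k)%N -> a k = c -> recurrent c.
  move=> c; have [rc|nrc] := pselect (recurrent c); first by exists 0%N.
  have [N NP] : exists N, forall k, (N <= k)%N -> a k <> c.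
    apply: contrapT => H; apply: nrc => N; apply: contrapT => H'.
    apply: H; exists N => k Nk ak; apply: H'; by exists k.
  by exists N => k Nk ak; case: (NP k Nk ak).
exists (\max_c N c) => k Kk; apply: (NP (a k) k) => //.
exact: leq_trans (leq_bigmax (a k)) Kk.
Qed.

(** If [a j = c] and [ell j] exceeds the window, p^(oo) looks around position [ell j], counted from
    1, like [lead c] around 0; recurrence supplies such a [j]. *)
Lemma lead_subshift c : recurrent c -> toeplitz_subshift a n (lead c).
Proof.
move=> rc k m; have [j jN aj] := rc (`|k| + m + 1)%N.
have kj : (`|k| + m + 1 < ell j)%N by exact: leq_ltn_trans (ell_gt j).
exists `|(k + (ell j)%:Z - 1)%R|%N; apply/mkseq_eq => i im; rewrite toeplitz_limitE.
have -> : (`|(k + (ell j)%:Z - 1)%R| + i).+1%N = `|((ell j)%:Z + (k + i%:Z))%R|%N by lia.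
rewrite /lead; have [->|ki0] := eqVneq (k + i%:Z) 0.
  by rewrite addr0 absz_nat level_ell aj.
rewrite (@level_period j (ell j)) ?absz_nat // gtnNdvd //; lia.
Qed.

(** To the right of 0, [lead b] is p^(oo) moved by one place. *)
Lemma subshift_lead b w (k : int) m : toeplitz_subshift a n w ->
  exists z : int, forall i : nat, (i < m)%N -> w (k + i%:Z) = lead b (z + i%:Z).
Proof.
move=> /(_ k m) [l /mkseq_eq wl]; exists l.+1%:Z => i im.
rewrite wl // toeplitz_limitE /lead; case: eqVneq => [|_]; first by lia.
by congr (a (level _)); lia.
Qed.

Lemma lead_recurrent b K k (x : int) : recurrent b ->
  (forall k, (K <= k)%N -> recurrent (a k)) -> (K <= k)%N -> (ell k %| `|x|)%N ->
  recurrent (lead b x).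
Proof.
move=> rb KP Kk kx; rewrite /lead; case: eqVneq => // x0.
apply: KP; apply: leq_trans Kk _; rewrite -dvd_level // lt0n absz_eq0 //.
Qed.

(* A window of length at least [ell K] is centred at a position of maximal level J;
   the other positions of level J in the window are too close to the centre to
   be at distance [ell J.+1]. *)
Lemma factor_lead K : (forall k, (K <= k)%N -> recurrent (a k)) ->
  forall l m, (ell K <= m)%N -> exists2 c, recurrent c & exists2 k, (k <= m)%N &
    forall i, (i < m)%N -> toeplitz_limit a n (l + i) = lead c (- k%:Z + 1 + i%:Z).
Proof.
move=> KP l m Km.
have window k : (ell k <= m)%N -> exists2 i, (i < m)%N & (ell k %| (l + i).+1)%N.
  move=> km; have k0 := ell_gt0 k.
  exists ((ell k).-1 - l %% ell k)%N; first by have := ltn_pmod l k0; lia.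
  apply/dvdnP; exists (l %/ ell k).+1.
  have := divn_eq l (ell k); have := ltn_pmod l k0; nia.
have m0 : (0 < m)%N by exact: leq_trans (ell_gt0 K) Km.
have [q qmax] : exists q : 'I_m, forall i, (i < m)%N -> (level (l + i).+1 <= level (l + q).+1)%N.
  case: (@arg_maxnP _ (Ordinal m0) xpredT (fun i : 'I_m => level (l + i).+1)) => // q _ H.
  by exists q => i im; exact: (H (Ordinal im)).
set J := level (l + q).+1 in qmax.
have KJ : (K <= J)%N.
  have [i im] := window K Km; rewrite dvd_level // => /leq_trans; apply.
  exact: qmax.
have mJ : (m < ell J.+1)%N.
  rewrite ltnNge; apply/negP => /window [i im]; rewrite dvd_level //.
  by move=> /leq_trans /(_ (qmax i im)); rewrite ltnn.
exists (a J); first exact: KP.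
exists q.+1 => // i im; rewrite toeplitz_limitE /lead.
have -> : - q.+1%:Z + 1 + i%:Z = i%:Z - q%:Z by lia.
case: eqVneq => [iq|iq]; first by have -> : i = q by lia.
have Jq : (ell J %| `|(l + q).+1%:Z|)%N by rewrite absz_nat dvd_level.
have e : (l + i).+1 = `|((l + q).+1%:Z + (i%:Z - q%:Z))%R|%N by lia.
have [JD|nJD] := boolP (ell J %| `|(i%:Z - q%:Z)%R|)%N; last by rewrite e (level_period Jq).
have qm := ltn_ord q.
congr a; transitivity J.
  apply/eqP; rewrite eqn_leq qmax //= -dvd_level //.
  by rewrite e dvdn_absDr.
apply/esym/level_uniq => //; first by lia.
by rewrite gtnNdvd //; lia.
Qed.

End ToeplitzCombinatorics.

(** * Cocycles over blocks *)

Section Cocycles.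
Variables (R : realType) (Alph : finType) (a : nat -> Alph) (n : nat -> nat).
Hypothesis n2 : forall k, (2 <= n k)%N.
Variable A : (int -> Alph) -> 'M[R]_2.
Let Omega := toeplitz_subshift a n.
Hypothesis A1 : SL2_valued Omega A.
Implicit Types (w v : int -> Alph) (x z : int).

Lemma shift_shift i j w : shift j (shift i w) = shift (i + j) w.
Proof. by apply/funext => x; rewrite /shift -addrA (addrC j). Qed.

Lemma forward_cocycleD m1 m2 w : forward_cocycle A (m1 + m2) w =
  forward_cocycle A m2 (shift m1%:Z w) *m forward_cocycle A m1 w.
Proof.
elim: m2 => [|m2 IH]; first by rewrite addn0 mul1mx.
by rewrite addnS /= IH mulmxA shift_shift PoszD.
Qed.

Lemma shift_Omega x w : Omega w -> Omega (shift x w).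
Proof. exact: shift_toeplitz_subshift. Qed.
Hint Resolve shift_Omega : core.

Lemma det_forward m w : Omega w -> \det (forward_cocycle A m w) = 1.
Proof.
move=> Ow; elim: m => [|m IH] /=; first by rewrite det1.
by rewrite det_mulmx1 // A1 //; exact: shift_Omega.
Qed.

Lemma backward_inv m w : Omega w ->
  backward_cocycle A m w = invmx (forward_cocycle A m (shift (- m%:Z) w)).
Proof.
move=> Ow; elim: m => [|m IH]; first by rewrite /= invmx1.
rewrite -[X in forward_cocycle A X]add1n forward_cocycleD /= mulmx1.
rewrite !shift_shift addr0 invmxM ?det_forward ?A1 //; try exact: shift_Omega.
by rewrite IH (_ : - m.+1%:Z + 1 = - m%:Z) //; lia.
Qed.

Variable N : nat.
Hypothesis AN : forall w v, Omega w -> Omega v ->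
  (forall i : int, - N%:Z <= i <= N%:Z -> w i = v i) -> A w = A v.

Lemma forward_local m w v : Omega w -> Omega v ->
  (forall i : int, - N%:Z <= i < m%:Z + N%:Z -> w i = v i) ->
  forward_cocycle A m w = forward_cocycle A m v.
Proof.
move=> Ow Ov; elim: m => //= m IH wv; rewrite IH; last by move=> i iN; apply: wv; lia.
by congr (_ *m _); apply: AN => [||i iN]; try exact: shift_Omega; apply: wv; lia.
Qed.

(** On [Omega] only finitely many central words of length 2 N + 1 determine [A]; words that do not
    occur get the dummy bound 0. *)
Lemma cocycle_bounded : exists2 M : R, 1 <= M & forall w, Omega w -> fnorm (A w) <= M.
Proof.
pose wd w := [ffun i : 'I_(2 * N).+1 => w (i%:Z - N%:Z)].
have /choice [M MP] : forall u : {ffun 'I_(2 * N).+1 -> Alph}, exists M,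
    forall w, Omega w -> wd w = u -> fnorm (A w) <= M.
  move=> u; have [[v [Ov vu]]|nv] := pselect (exists v, Omega v /\ wd v = u).
    exists (fnorm (A v)) => w Ow wu; rewrite (AN Ow Ov) // => i iN.
    have ilt : (`|(i + N%:Z)%R| < (2 * N).+1)%N by lia.
    have /ffunP /(_ (Ordinal ilt)) := etrans wu (esym vu).
    by rewrite !ffunE /= (_ : _ - _ = i) //; lia.
  by exists 0 => w Ow wu; case: nv; exists w.
exists (1 + \sum_u `|M u|) => [|w Ow].
  by rewrite lerDl sumr_ge0.
apply: le_trans (MP _ _ Ow erefl) _; rewrite (bigD1 (wd w)) //=.
apply: le_trans (ler_norm _) _.
by have : 0 <= \sum_(u | u != wd w) `|M u| by [rewrite sumr_ge0]; lra.
Qed.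

Lemma forward_bounded (M : R) m w : 1 <= M -> (forall w, Omega w -> fnorm (A w) <= M) ->
  Omega w -> fnorm (forward_cocycle A m w) <= 2 * M ^+ m.
Proof.
move=> M1 AM Ow.
have -> : forward_cocycle A m w = bprod (fun i => A (shift i%:Z w)) m.
  by elim: m => //= m ->.
by apply: fnorm_bprod_le => // i; apply: AM; exact: shift_Omega.
Qed.

Local Notation ell := (ell n).
Local Notation lead := (lead a n).
Local Notation recurrent := (recurrent a).

(* The cocycle over a block p^(k) c, moved right by N so that it depends only
   on the surrounding word p^(k) c p^(k). *)
Definition block (k : nat) (c : Alph) : 'M[R]_2 :=
  forward_cocycle A (ell k) (shift (1 + N%:Z - (ell k)%:Z) (lead c)).

(** The product reads only the positions from x + 1 - ell k to x + 2 N, all at distance less than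
    [ell k] from [x]. *)
Lemma forward_block k c w x : (2 * N < ell k)%N -> recurrent c -> Omega w ->
  (forall i : int, (`|i| < ell k)%N -> w (x + i) = lead c i) ->
  forward_cocycle A (ell k) (shift (x + 1 + N%:Z - (ell k)%:Z) w) = block k c.
Proof.
move=> kN rc Ow wc; apply: forward_local => [||i iN].
- exact: shift_Omega.
- by apply: shift_Omega; exact: lead_subshift.
rewrite /shift (_ : i + (x + 1 + N%:Z - (ell k)%:Z) = x + (i + (1 + N%:Z - (ell k)%:Z))).
  by apply: wc; lia.
by lia.
Qed.

Lemma det_block k c : recurrent c -> \det (block k c) = 1.
Proof. by move=> rc; apply: det_forward; apply: shift_Omega; exact: lead_subshift. Qed.

Variable K : nat.
Hypothesis KP : forall k, (K <= k)%N -> recurrent (a k).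
Hypothesis KN : (2 * N < ell K)%N.

Let kN k : (K <= k)%N -> (2 * N < ell k)%N.
Proof. by move=> Kk; apply: leq_trans KN _; exact: leq_ell. Qed.

Lemma dvdn_ell_step k x i : (ell k %| `|x|)%N -> (ell k %| `|(x + (i * ell k)%:Z)%R|)%N.
Proof. by move=> kx; rewrite (dvdn_absDr _ kx) absz_nat dvdn_mull. Qed.

Lemma forward_blocks b k q x : recurrent b -> (K <= k)%N -> (ell k %| `|x|)%N ->
  forward_cocycle A (q * ell k) (shift (x + 1 + N%:Z - (ell k)%:Z) (lead b)) =
  bprod (fun i => block k (lead b (x + (i * ell k)%:Z))) q.
Proof.
move=> rb Kk kx; elim: q => //= q IH.
rewrite mulSn addnC forward_cocycleD IH shift_shift; congr (_ *m _).
rewrite (_ : _ + _ = x + (q * ell k)%:Z + 1 + N%:Z - (ell k)%:Z); last by lia.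
have kxq := dvdn_ell_step q kx.
apply: forward_block => [|||i ik].
- exact: kN.
- exact: (lead_recurrent n2 rb KP Kk).
- exact: lead_subshift.
exact: (lead_center a n2 b kxq ik).
Qed.

(** Cut the large block at multiples of [ell k]: the last one is 0 and carries [c], the n_k - 1
    before it have level [k] and carry [a k]. *)
Lemma blockS k c : recurrent c -> (K <= k)%N ->
  block k.+1 c = block k c *m block k (a k) ^+ (n k).-1.
Proof.
move=> rc Kk; have k0 := ell_gt0 n2 k.
have nk : n k = (n k).-1.+1 by rewrite prednK // (leq_trans _ (n2 k)).
pose x := (ell k)%:Z - (ell k.+1)%:Z.
have kx : (ell k %| `|x|)%N.
  have -> : x = (1 - (n k)%:Z) * (ell k)%:Z by rewrite /x ellS mulrBl mul1r.
  by rewrite abszM dvdn_mull.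
have -> : block k.+1 c = bprod (fun i => block k (lead c (x + (i * ell k)%:Z))) (n k).
  rewrite -forward_blocks // -ellS /block.
  by have -> : x + 1 + N%:Z - (ell k)%:Z = 1 + N%:Z - (ell k.+1)%:Z by rewrite /x; lia.
rewrite nk /=; congr (_ *m _).
  by rewrite (_ : x + _ = 0) ?lead0 // /x ellS {2}nk; lia.
suff bq q : (q <= (n k).-1)%N ->
    bprod (fun i => block k (lead c (x + (i * ell k)%:Z))) q = block k (a k) ^+ q.
  exact: bq.
elim: q => // q IH qn; rewrite exprS -mulmxE /= IH ?(ltnW qn) //; congr (block k _ *m _).
have xq : `|(x + (q * ell k)%:Z)%R|%N = (((n k).-1 - q) * ell k)%N.
  by rewrite /x ellS {1}nk mulnBl; nia.
have nq : (0 < (n k).-1 - q)%N by rewrite subn_gt0.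
rewrite /lead xq; case: eqVneq => [x0|_].
  by move: xq; rewrite x0 absz0 => /esym/eqP; rewrite muln_eq0 !gtn_eqF.
congr a; apply: level_uniq => //; [by rewrite muln_gt0 nq | exact: dvdn_mull |].
by rewrite ellS dvdn_pmul2r // gtnNdvd //; lia.
Qed.

Variable b : Alph.
Hypothesis rb : recurrent b.

(** The matrix E_c, read off at level [K]; letters that are not recurrent get the identity so that
    every determinant is 1. *)
Definition letter_mx (c : Alph) : 'M[R]_2 :=
  if c \in eventual_alphabet a then block K c *m invmx (block K b) else 1%:M.

Lemma det_letter_mx c : \det (letter_mx c) = 1.
Proof.
rewrite /letter_mx; case: recurrentP => [rc|_]; last by rewrite det1.
by rewrite det_mulmx1 ?det_invmx1 ?det_block.
Qed.

(** By [blockS] the right factor gained from one level to the next does not depend on [c], so the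
    quotient of two blocks persists. *)
Lemma block_letter k c : recurrent c -> (K <= k)%N ->
  block k c = letter_mx c *m block k b.
Proof.
move=> rc; elim: k => [|k IH].
  rewrite leqn0 => /eqP K0; rewrite /letter_mx; case: recurrentP => // _.
  by rewrite K0 mulmxKV ?sl2_unit ?det_block.
rewrite leq_eqVlt ltnS => /predU1P[<-|Kk].
  rewrite /letter_mx; case: recurrentP => // _.
  by rewrite mulmxKV ?sl2_unit ?det_block.
by rewrite !blockS // IH // mulmxA.
Qed.

(* Every point of Omega looks, on a finite window, like a point of the orbit of
   [lead b]; cutting there at block boundaries leaves two short ends. *)
Lemma forward_sandwich (M : R) : 1 <= M -> (forall w, Omega w -> fnorm (A w) <= M) ->
  forall k m w, (K <= k)%N -> (ell k <= m)%N -> Omega w ->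
  exists q x, [/\ (ell k %| `|x|)%N, (q * ell k <= m)%N, (m <= q * ell k + 2 * ell k)%N &
    let G := bprod (fun i => block k (lead b (x + (i * ell k)%:Z))) q in
    let B := 2 * M ^+ ell k * (2 * M ^+ ell k) in
    fnorm (forward_cocycle A m w) <= B * fnorm G /\
    fnorm G <= B * fnorm (forward_cocycle A m w)].
Proof.
move=> M1 AM k m w Kk km Ow; have k0 := ell_gt0 n2 k.
have Ob : Omega (lead b) by exact: lead_subshift.
have [z' wz'] := subshift_lead n2 b (- N%:Z) (m + 2 * N) Ow.
pose z := z' + N%:Z.
have -> : forward_cocycle A m w = forward_cocycle A m (shift z (lead b)).
  apply: forward_local => // [|i iN]; first exact: shift_Omega.
  have := wz' `|(i + N%:Z)%R|%N; rewrite /shift.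
  rewrite (_ : - N%:Z + _ = i); last by lia.
  by rewrite (_ : z' + _ = i + z); [apply; lia | rewrite /z; lia].
(* The distance to the next block boundary; boundaries are the positions congruent to 1 + N modulo
   [ell k]. *)
pose h := `|((1 + N%:Z - z) %% (ell k)%:Z)%Z|%N.
have k0' : (ell k)%:Z != 0 by rewrite -lt0n in k0 *; lia.
have hE : h%:Z = ((1 + N%:Z - z) %% (ell k)%:Z)%Z.
  by rewrite /h gez0_abs // modz_ge0.
have hk : (h < ell k)%N.
  by have := ltz_pmod (1 + N%:Z - z) (d := (ell k)%:Z); rewrite -hE; lia.
pose x := z + h%:Z - 1 - N%:Z + (ell k)%:Z.
have kx : (ell k %| `|x|)%N.
  have dE := divz_eq (1 + N%:Z - z) (ell k)%:Z; rewrite -hE in dE.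
  rewrite (_ : x = (1 - ((1 + N%:Z - z) %/ (ell k)%:Z)%Z) * (ell k)%:Z).
    by rewrite abszM dvdn_mull.
  by rewrite /x mulrBl mul1r; lia.
pose q := ((m - h) %/ ell k)%N; pose r := ((m - h) %% ell k)%N.
have mE : m = (h + q * ell k + r)%N by have := divn_eq (m - h) (ell k); rewrite -/q -/r; lia.
have rk : (r < ell k)%N by exact: ltn_pmod.
exists q, x; split=> //; [by lia | by lia |].
set G := bprod _ q; set B := 2 * _ * _.
have dG : \det G = 1.
  apply: det_bprod => i; apply: det_block.
  by apply: (lead_recurrent n2 rb KP Kk); exact: dvdn_ell_step.
have GE : forward_cocycle A (q * ell k) (shift (z + h%:Z) (lead b)) = G.
  rewrite /G -forward_blocks //.
  by have -> : x + 1 + N%:Z - (ell k)%:Z = z + h%:Z by rewrite /x; lia.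
rewrite mE forward_cocycleD forward_cocycleD !shift_shift GE.
set T := forward_cocycle A r _; set H := forward_cocycle A h _.
have dT : \det T = 1 by apply: det_forward; exact: shift_Omega.
have dH : \det H = 1 by apply: det_forward; exact: shift_Omega.
have bnd i : (i < ell k)%N -> 2 * M ^+ i <= 2 * M ^+ ell k.
  by move=> ik; rewrite ler_pM2l // ler_weXn2l // ltnW.
have TB : fnorm T <= 2 * M ^+ ell k.
  by apply: le_trans (bnd _ rk); apply: forward_bounded => //; exact: shift_Omega.
have HB : fnorm H <= 2 * M ^+ ell k.
  by apply: le_trans (bnd _ hk); apply: forward_bounded => //; exact: shift_Omega.
have B0 : 0 <= 2 * M ^+ ell k by apply: le_trans (fnorm_ge0 T) TB.
split.
  apply: le_trans (fnorm_mul _ _) _; rewrite /B -mulrA; apply: ler_pM; rewrite ?fnorm_ge0 //.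
  apply: le_trans (fnorm_mul _ _) _; rewrite mulrC.
  by rewrite ler_wpM2r ?fnorm_ge0.
rewrite /B -mulrA.
apply: le_trans (fnorm_mul_ge_r _ dH) _; rewrite mulrC; apply: ler_pM; rewrite ?fnorm_ge0 //.
apply: le_trans (fnorm_mul_ge_l _ dT) _.
by rewrite ler_wpM2r ?fnorm_ge0.
Qed.

(** Fix one large level [k] and let the number of blocks grow. Submultiplicativity bounds the norm
    from above; [pair_growth] supplies the hypothesis of [avalanche], which bounds it from below. *)
Lemma uniform_fnorm : exists Lam : R, forall eps, 0 < eps ->
  exists m0, forall m w, (m0 <= m)%N -> Omega w ->
  `|ln (fnorm (forward_cocycle A m w)) - Lam * m%:R| <= eps * m%:R.
Proof.
have [M M1 AM] := cocycle_bounded.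
pose X k := block (K + k) b; pose a' k := a (K + k)%N; pose n' k := n (K + k)%N.
pose l' k := ell (K + k)%N; pose L k : R := (l' k)%:R.
pose C : R := 1 + \sum_c fnorm (letter_mx c).
have n2' k : (2 <= n' k)%N by exact: n2.
have l0' : (0 < l' 0)%N by exact: ell_gt0.
have lS' k : l' k.+1 = (n' k * l' k)%N by rewrite /l' addnS ellS.
have dX k : \det (X k) = 1 by exact: det_block.
have EC c : fnorm (letter_mx c) <= C.
  rewrite /C (bigD1 c) //=.
  have : 0 <= \sum_(d | d != c) fnorm (letter_mx d).
    by apply: sumr_ge0 => d _; exact: fnorm_ge0.
  lra.
have XS k : X k.+1 = X k *m (letter_mx (a' k) *m X k) ^+ (n' k).-1.
  have Kk := leq_addr k K.
  by rewrite /X addnS blockS // (block_letter (KP Kk)).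
have [Lam [Lam0 LamX XLam]] :=
  growth_rate n2' l0' lS' det_letter_mx (dX 0%N) EC XS.
have C1 : 1 <= C by rewrite lerDl; apply: sumr_ge0 => c _; exact: fnorm_ge0.
have Cp : 0 < C by exact: lt_le_trans C1.
have L0 k : 0 < L k by rewrite ltr0n; exact: ell_gt0.
have L_infty (y : R) : \forall k \near \oo, y <= L k.
  near=> k; apply: (@le_trans _ _ k%:R).
    by near: k; exact: nbhs_infty_ger.
  by rewrite ler_nat (leq_trans (leq_addl K k)) // ltnW // ell_gt.
pose g k x i := block (K + k) (lead b (x + (i * l' k)%:Z)).
have rg k x i : (l' k %| `|x|)%N -> recurrent (lead b (x + (i * l' k)%:Z)).
  by move=> kx; apply: (lead_recurrent n2 rb KP (leq_addr k K)); exact: dvdn_ell_step.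
have gE k x i : (l' k %| `|x|)%N ->
    g k x i = letter_mx (lead b (x + (i * l' k)%:Z)) *m X k.
  by move=> kx; rewrite /g (block_letter (rg k x i kx) (leq_addr k K)).
have dg k x i : (l' k %| `|x|)%N -> \det (g k x i) = 1.
  by move=> kx; rewrite gE // det_mulmx1 // det_letter_mx.
have gC k x i : (l' k %| `|x|)%N -> fnorm (g k x i) <= C * fnorm (X k).
  move=> kx; rewrite gE //; apply: le_trans (fnorm_mul _ _) _.
  by rewrite ler_wpM2r ?fnorm_ge0.
pose D k := 2 * M ^+ l' k * (2 * M ^+ l' k).
have D1 k : 1 <= D k by rewrite /D; have := exprn_ege1 (l' k) M1; nra.
pose B k := ln (D k).
have lnD k y : 0 < y -> ln (D k * y) = B k + ln y.
  have := lt_le_trans ltr01 (D1 k); rewrite /B; move: (D k) => d d0 y0.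
  by rewrite lnM ?posrE.
have sandwich k m w : (l' k <= m)%N -> Omega w -> exists q x,
    [/\ (l' k %| `|x|)%N, (q * l' k <= m)%N, (m <= q * l' k + 2 * l' k)%N &
     `|ln (fnorm (forward_cocycle A m w)) - ln (fnorm (bprod (g k x) q))| <= B k].
  move=> km Ow; have [q [x [kx qm mq [le1 le2]]]] :=
    forward_sandwich M1 AM (leq_addr k K) km Ow.
  exists q, x; split=> //.
  have F1 : 0 < fnorm (forward_cocycle A m w).
    by apply: lt_le_trans (fnorm_ge1 (det_forward m Ow)).
  have F2 : 0 < fnorm (bprod (g k x) q).
    by apply: lt_le_trans (fnorm_ge1 (det_bprod q (fun i => dg k x i kx))).
  have := ln_le_mono F1 (le1 : _ <= D k * fnorm (bprod (g k x) q)).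
  have := ln_le_mono F2 (le2 : fnorm (bprod (g k x) q) <= D k * _).
  rewrite !lnD // => le3 le4.
  by rewrite ler_norml; apply/andP; split; lra.
have B0 k : 0 <= B k by exact: ln_ge0.
exists Lam => eps eps0.
have [m1 up] : exists m1, forall m w, (m1 <= m)%N -> Omega w ->
    ln (fnorm (forward_cocycle A m w)) <= (Lam + eps) * m%:R.
  have [k _ /(_ k (leqnn k)) XL] : \forall k \near \oo,
      ln (fnorm (X k)) + ln C <= (Lam + eps / 2) * L k by apply: XLam; lra.
  have [m1 _ m1P] : \forall m \near \oo, (ln 2 + B k) / (eps / 2) <= m%:R.
    exact: nbhs_infty_ger.
  exists (maxn m1 (l' k)) => m w; rewrite geq_max => /andP[mm1 mk] Ow.
  have [q [x [kx qm mq]]] := sandwich k m w mk Ow.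
  rewrite ler_norml => /andP[_ le1].
  have CX1 : 1 <= C * fnorm (X k) by have := fnorm_ge1 (dX k); nra.
  have CX0 : 0 < C * fnorm (X k) by exact: lt_le_trans CX1.
  have F2 : 0 < fnorm (bprod (g k x) q).
    by apply: lt_le_trans (fnorm_ge1 (det_bprod q (fun i => dg k x i kx))).
  have /(ln_le_mono F2) := fnorm_bprod_le q CX1 (fun i => gC k x i kx).
  rewrite lnM ?posrE ?exprn_gt0 // lnXn // lnM ?posrE //; last by rewrite (lt_le_trans _ (fnorm_ge1 (dX k))).
  rewrite -[_ *+ q]mulr_natr => le2.
  have le3 : (ln C + ln (fnorm (X k))) * q%:R <= (Lam + eps / 2) * m%:R.
    apply: (@le_trans _ _ ((Lam + eps / 2) * (q * l' k)%N%:R)).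
      by rewrite natrM (mulrC q%:R) mulrA ler_wpM2r // addrC.
    by rewrite ler_wpM2l ?ler_nat //; lra.
  have := m1P m mm1; rewrite /= ler_pdivrMr; last by lra.
  lra.
have [m2 lo] : exists m2, forall m w, (m2 <= m)%N -> Omega w ->
    (Lam - eps) * m%:R <= ln (fnorm (forward_cocycle A m w)).
  have [LamN|Lamp] := leP Lam 0.
    exists 0%N => m w _ Ow; apply: (@le_trans _ _ 0).
      by rewrite mulr_le0_ge0 //; lra.
    by rewrite ln_ge0 // fnorm_ge1 // det_forward.
  pose eta := Num.min eps Lam / 8.
  have [eta0 eta_eps eta_Lam] : [/\ 0 < eta, 8 * eta <= eps & 8 * eta <= Lam].
    have p0 : 0 < Num.min eps Lam by rewrite lt_min eps0.
    have p1 : Num.min eps Lam <= eps by rewrite ge_min lexx.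
    have p2 : Num.min eps Lam <= Lam by rewrite ge_min lexx orbT.
    by rewrite /eta; split; lra.
  have [k [XL XX Lk]] : exists k, [/\
      ln (fnorm (X k)) + ln C <= (Lam + eta) * L k,
      (forall c, recurrent c ->
         expR ((2 * Lam - eta) * L k) <= fnorm (X k *m letter_mx c *m X k)) &
      4 * C / eta <= L k].
    apply: (@filter_ex _ \oo); near=> k; split.
    - by near: k; exact: XLam.
    (* The alphabet is finite, so one [k] serves all letters. *)
    - near: k; apply: filter_forall => c.
      have [rc|nrc] := pselect (recurrent c); last by near=> k.
      near=> k => _; near: k.
      apply: (pair_growth n2' l0' lS' det_letter_mx (dX 0%N) EC XS Lamp LamX XLam) => //.
      move=> P; have [j jP aj] := rc (K + P)%N.
      exists (j - K)%N; first by rewrite leq_subRL // (leq_trans (leq_addr P K)).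
      by rewrite /a' subnKC // (leq_trans (leq_addr P K)).
    - by near: k; exact: L_infty.
  have [m2 _ m2P] : \forall m \near \oo, (3 * Lam * L k + B k) / (eps / 2) <= m%:R.
    exact: nbhs_infty_ger.
  exists (maxn m2 (l' k)) => m w; rewrite geq_max => /andP[mm2 mk] Ow.
  have [q [x [kx qm mq]]] := sandwich k m w mk Ow.
  rewrite ler_norml => /andP[le1 _].
  (* [expR h] is the expansion per block: the rate 2 Lam - eta of a pair, less Lam + eta for one
     block and a further eta for the constants. *)
  pose h := (Lam - 3 * eta) * L k.
  have h0 : 0 <= h by apply: mulr_ge0; have := L0 k; lra.
  have e1 : 1 <= expR h by rewrite -expR0 ler_expR.
  have gX i : fnorm (g k x i) <= expR ((Lam + eta) * L k).
    apply: le_trans (gC k x i kx) _.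
    have Xp : 0 < fnorm (X k) by apply: lt_le_trans (fnorm_ge1 (dX k)).
    by apply: ln_le_expR; rewrite ?mulr_gt0 // lnM ?posrE // addrC.
  (* Stripping the left letter matrix costs a factor [C]; together with 2 (expR h + 1) <= 4 expR h
     this explains the [4 * C] in the choice of [k]. *)
  have gg i : 2 * (expR h + 1) * expR ((Lam + eta) * L k) <= fnorm (g k x i.+1 *m g k x i).
    have := fnorm_mul_ge_l (X k *m g k x i) (det_letter_mx (lead b (x + (i.+1 * l' k)%:Z))).
    rewrite [X in _ * fnorm X]mulmxA -gE // => le2.
    have {}le2 : fnorm (X k *m g k x i) <= C * fnorm (g k x i.+1 *m g k x i).
      by apply: le_trans le2 _; rewrite ler_wpM2r ?fnorm_ge0.
    rewrite {1}(gE k x i kx) mulmxA in le2.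
    have le3 := le_trans (XX _ (rg k x i kx)) le2.
    have le4 : 4 * C <= expR (eta * L k).
      apply: le_trans (ltW (expR_gt _)); rewrite [leRHS]mulrC -ler_pdivrMr //.
    have e3 : expR ((2 * Lam - eta) * L k) = expR (eta * L k) * (expR h * expR ((Lam + eta) * L k)).
      by rewrite -!expRD; congr expR; rewrite /h; ring.
    rewrite e3 in le3.
    have e4 : 0 < expR ((Lam + eta) * L k) by exact: expR_gt0.
    rewrite -(ler_pM2l Cp); apply: le_trans le3.
    have le5 : 4 * C * (expR h * expR ((Lam + eta) * L k)) <=
       expR (eta * L k) * (expR h * expR ((Lam + eta) * L k)).
      by rewrite ler_wpM2r // mulr_ge0 ?expR_ge0.
    apply: le_trans le5.
    have : C * expR ((Lam + eta) * L k) <= C * expR ((Lam + eta) * L k) * expR h.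
      by rewrite ler_peMr // mulr_ge0 ?expR_ge0 // ltW.
    lra.
  have mu2 : 2 <= expR h + 1 by lra.
  have aval := avalanche (fun i => dg k x i kx) gX gg mu2.
  have le2 : (q%:R - 1) * h <= ln (fnorm (bprod (g k x) q)).
    case: (q) => [|p].
      apply: (@le_trans _ _ 0); first by lra.
      by rewrite ln_ge0 // fnorm_ge1 // det1.
    have := aval p; rewrite addrK => /ln_le_mono; rewrite exprn_gt0 ?expR_gt0 // => /(_ isT).
    rewrite lnXn ?expR_gt0 // expRK -mulr_natl -natr1; lra.
  have := m2P m mm2; rewrite /= ler_pdivrMr; last by lra.
  have : m%:R <= q%:R * L k + 2 * L k :> R by rewrite -!natrM -natrD ler_nat.
  have := L0 k.
  have m0 : 0 <= m%:R :> R by [].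
  move=> Lk0 le3 le4.
  (* [avalanche] loses one block and the two ends lose at most two block lengths, hence
     [3 * L k]. *)
  have le5 : (m%:R - 3 * L k) * (Lam - 3 * eta) <= (q%:R - 1) * h.
    have -> : (q%:R - 1) * h = (Lam - 3 * eta) * ((q%:R - 1) * L k).
      by rewrite /h; ring.
    by rewrite [leLHS]mulrC ler_wpM2l; lra.
  have le6 : eta * m%:R * 8 <= eps * m%:R.
    by have := ler_wpM2r m0 eta_eps; lra.
  have le7 : 0 <= eta * L k by apply: mulr_ge0; lra.
  have le8 : 0 <= eps * m%:R by apply: mulr_ge0; lra.
  lra.
exists (maxn m1 m2) => m w; rewrite geq_max => /andP[mm1 mm2] Ow.
have := up m w mm1 Ow; have := lo m w mm2 Ow.
by rewrite ler_norml => ? ?; apply/andP; split; lra.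
Unshelve. all: by end_near. Qed.

(* Gordon's three-block argument: around the origin of [lead c] the block
   matrix D repeats three times when a_k = c, and D^2 - (tr D) D + 1 = 0. *)
Lemma gordon c k (v : 'cV[R]_2) : recurrent c -> (K <= k)%N -> a k = c ->
  enorm (forward_cocycle A N.+1 (lead c) *m v) <=
    enorm (forward_cocycle A (N.+1 + ell k) (lead c) *m v) +
    enorm (backward_cocycle A (ell k - N.+1) (lead c) *m v) +
    enorm (backward_cocycle A (2 * ell k - N.+1) (lead c) *m v).
Proof.
move=> rc Kk akc; have kN' := kN Kk; set w := lead c; pose D := block k c.
have Ow : Omega w by exact: lead_subshift.
have dD : \det D = 1 by exact: det_block.
have lE : lead c (ell k)%:Z = c.
  rewrite /lead; case: eqVneq => // _.
  by rewrite absz_nat level_ell.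
have lEN : lead c (- (ell k)%:Z) = c.
  rewrite /lead; case: eqVneq => // _.
  by rewrite abszN absz_nat level_ell.
have center x : (ell k %| `|x|)%N -> lead c x = c ->
    forward_cocycle A (ell k) (shift (x + 1 + N%:Z - (ell k)%:Z) w) = D.
  by move=> kx xc; apply: forward_block => // i ik; rewrite /w (lead_center a n2 c kx ik) xc.
(* Block boundaries lie at N + 1 modulo [ell k]. The middle one of the three blocks contains the
   origin, where it splits as D = F P, with F the cocycle up to time N + 1. *)
have Dfwd : forward_cocycle A (N.+1 + ell k) w = D *m forward_cocycle A N.+1 w.
  rewrite forward_cocycleD -(center (ell k)%:Z) ?absz_nat //.
  by rewrite (_ : _ - _ = N.+1%:Z) //; lia.
pose p := (ell k - N.+1)%N.
have pE : (p%:Z = (ell k)%:Z - N.+1%:Z) by rewrite /p; lia.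
pose P := forward_cocycle A p (shift (- p%:Z) w).
have dP : \det P = 1 by apply: det_forward; exact: shift_Omega.
have DP : D = forward_cocycle A N.+1 w *m P.
  rewrite -(center 0) ?absz0 ?dvdn0 // (_ : 0 + 1 + N%:Z - (ell k)%:Z = - p%:Z); last by lia.
  rewrite -[X in forward_cocycle A X _](_ : (p + N.+1 = ell k)%N); last by rewrite /p; lia.
  rewrite forward_cocycleD shift_shift addNr; congr (forward_cocycle A _ _ *m _).
  by apply/funext => i; rewrite /shift addr0.
have DPN : forward_cocycle A (2 * ell k - N.+1) (shift (- (2 * ell k - N.+1)%N%:Z) w) = P *m D.
  rewrite (_ : (2 * ell k - N.+1)%N = (ell k + p)%N); last by rewrite /p; lia.
  rewrite forward_cocycleD shift_shift -(center (- (ell k)%:Z)) ?abszN ?absz_nat //.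
  have -> : - (ell k + p)%N%:Z + (ell k)%:Z = - p%:Z by lia.
  by have -> : - (ell k)%:Z + 1 + N%:Z - (ell k)%:Z = - (ell k + p)%N%:Z by lia.
move: (forward_cocycle A N.+1 w) DP Dfwd => F DP Dfwd.
rewrite !backward_inv // DPN -/p -/P invmxM // Dfwd -!mulmxA.
set v' := F *m v; set y := invmx P *m v; set y2 := invmx D *m y.
have Dy2 : D *m y2 = y by rewrite /y2 mulKVmx ?sl2_unit.
have Dy : D *m y = v' by rewrite DP -mulmxA /y mulKVmx ?sl2_unit.
have ch1 := sl2_cayley y dD; rewrite Dy in ch1.
have ch2 := sl2_cayley y2 dD; rewrite Dy2 Dy in ch2.
(* For a large trace use D v' + y = (tr D) v'; for a small one v' + y2 = (tr D) y. *)
have [t1|t1] := leP 1 `|\tr D|.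
  apply: (@le_trans _ _ (`|\tr D| * enorm v')).
    by rewrite ler_peMl ?enorm_ge0.
  rewrite -enormZ -ch1; apply: le_trans (enormD _ _) _.
  by rewrite lerDl enorm_ge0.
have -> : v' = \tr D *: y - y2 by rewrite -ch2 addrK.
apply: le_trans (enormD _ _) _; rewrite enormN enormZ.
have : `|\tr D| * enorm y <= enorm y.
  by rewrite ler_piMl ?enorm_ge0 // ltW.
by have := enorm_ge0 (D *m (\tr D *: y - y2)); lra.
Qed.

End Cocycles.

(** * The leading sequence condition *)

Section Growth.
Variables (R : realType) (Alph : finType) (a : nat -> Alph) (n : nat -> nat).
Hypothesis n2 : forall k, (2 <= n k)%N.
Let Omega := toeplitz_subshift a n.

(** The operator norm lies between half the Frobenius norm and the Frobenius norm, which costs ln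
    2. *)
Lemma growth_close (M : 'M[R]_2) (m : nat) (Lam eps : R) : (0 < m)%N -> \det M = 1 ->
  `|ln (fnorm M) - Lam * m%:R| <= eps / 2 * m%:R -> ln 2 <= eps / 2 * m%:R ->
  `|ln (operator_norm M) / m%:R - Lam| <= eps.
Proof.
move=> m0 dM; have F1 := fnorm_ge1 dM.
have := operator_norm_le M; have := operator_norm_ge M => le1 le2.
have N0 : 0 < operator_norm M by lra.
have := ln_le_mono N0 le2; have : 0 < fnorm M by lra.
move=> /ln_le_mono /(_ le1); rewrite lnM ?posrE // => le3 le4.
rewrite !ler_norml => /andP[le5 le6] le7; apply/andP.
have m0' : 0 < m%:R :> R by rewrite ltr0n.
by split; rewrite ?lerBrDr ?lerBlDr ?ler_pdivlMr ?ler_pdivrMr //; lra.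
Qed.

Lemma growthE (A : (int -> Alph) -> 'M[R]_2) w m :
  growth A w m%:Z = ln (operator_norm (forward_cocycle A m w)) / m%:R.
Proof. by []. Qed.

Lemma cocycleN (A : (int -> Alph) -> 'M[R]_2) w (m : nat) :
  cocycle A (- m%:Z) w = backward_cocycle A m w.
Proof. by case: m. Qed.

Lemma growthN (A : (int -> Alph) -> 'M[R]_2) w m :
  growth A w (- m%:Z) = ln (operator_norm (backward_cocycle A m w)) / m%:R.
Proof. by rewrite /growth cocycleN normrN. Qed.

Variable A : (int -> Alph) -> 'M[R]_2.
Hypotheses (A1 : SL2_valued Omega A) (Aloc : locally_constant Omega A).

(** The backward cocycle inverts a forward one started at a shifted point, and inversion keeps the
    Frobenius norm; uniformity in the starting point thus covers negative times. *)
Lemma uniform_growth : exists Lam : R, forall eps, 0 < eps ->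
  exists m0, forall m w, (m0 <= m)%N -> Omega w ->
  `|growth A w m%:Z - Lam| <= eps /\ `|growth A w (- m%:Z) - Lam| <= eps.
Proof.
have [N AN] := Aloc; have [K0 K0P] := eventually_recurrent a.
pose K := maxn K0 (2 * N).
have KP k : (K <= k)%N -> recurrent a (a k).
  by rewrite geq_max => /andP[/K0P].
have KN : (2 * N < ell n K)%N by apply: leq_ltn_trans (ell_gt n2 K); exact: leq_maxr.
have [Lam LamP] := uniform_fnorm n2 A1 AN KP KN (KP K (leqnn K)).
exists Lam => eps eps0; have [|m0 m0P] := LamP (eps / 2); first by lra.
have [m1 _ m1P] : \forall m \near \oo, ln 2 / (eps / 2) <= m%:R.
  exact: nbhs_infty_ger.
exists (maxn m0 m1).+1 => m w mm Ow.
have mm0 : (m0 <= m)%N by apply: leq_trans (ltnW mm); exact: leq_maxl.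
have mm1 : (m1 <= m)%N by apply: leq_trans (ltnW mm); exact: leq_maxr.
have m_gt0 : (0 < m)%N by exact: leq_ltn_trans mm.
have m1m : ln 2 <= eps / 2 * m%:R.
  by have := m1P m mm1; rewrite /= ler_pdivrMr; lra.
have Osh : Omega (shift (- m%:Z) w) by exact: shift_toeplitz_subshift.
rewrite growthE growthN (backward_inv A1) //; split; apply: growth_close => //.
- exact: (det_forward A1).
- exact: m0P.
- by rewrite det_invmx1 ?(det_forward A1).
- by rewrite fnorm_inv ?(det_forward A1) //; exact: m0P.
Qed.

Lemma toeplitz_uniform : uniform_cocycle Omega A.
Proof.
have [Lam LamP] := uniform_growth; exists Lam.
move=> P /uniform_nbhs [E [entE EP]].
move: entE; rewrite -entourage_ballE => -[e /= e0 eE].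
have [|m0 m0P] := LamP (e / 2); first by rewrite divr_gt0.
exists m0 => // m mm /=; apply: EP => w Ow; apply: eE => /=.
have [le1 _] := m0P m w mm Ow; rewrite distrC in le1.
by apply: le_lt_trans le1 _; have : 0 < e by []; lra.
Qed.

Lemma toeplitz_beta r (om : 'I_r -> int -> Alph) : (forall j, Omega (om j)) -> LSC_beta om A.
Proof.
move=> Oom; have [Lam LamP] := uniform_growth; exists Lam => j.
split; apply/cvgrPdist_le => eps eps0; have [m0 m0P] := LamP eps eps0;
  exists m0 => // m mm; rewrite distrC; by have [] := m0P m _ mm (Oom j).
Qed.

Lemma ln_rate_decay (u : nat -> R) (l : R) : (forall m, 0 < u m) -> l < 0 ->
  ln (u m) / m%:R @[m --> \oo] --> l -> forall r, 0 < r -> \forall m \near \oo, u m < r.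
Proof.
move=> u0 l0 ul r r0; near=> m.
have m0 : 0 < m%:R :> R by near: m; exact: nbhs_infty_gtr.
have : ln (u m) / m%:R < l / 2.
  by near: m; apply: (cvgr_lt l) => //; lra.
rewrite ltr_pdivrMr // => le1.
have : - (ln r) / (- l / 2) <= m%:R by near: m; exact: nbhs_infty_ger.
rewrite ler_pdivrMr; last by lra.
by move=> le2; rewrite -ltr_ln ?posrE //; lra.
Unshelve. all: by end_near. Qed.

(** If both rates were negative, then for large [k] with [a k = c] each term on the right of
    [gordon] would be below a third of the left side, which is positive and independent of [k]. *)
Lemma toeplitz_gamma r (om : 'I_r -> int -> Alph) :
  (forall j, exists2 c, recurrent a c & om j = lead a n c) -> LSC_gamma om A.
Proof.
move=> omc j v v0 [l1 [l2 []]]; have [c rc ->] := omc j; set w := lead a n c.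
have Ow : Omega w by exact: lead_subshift.
have pos (M : 'M[R]_2) : \det M = 1 -> 0 < enorm (M *m v).
  by move=> dM; rewrite enorm_gt0 -(mulmx0 _ M) (can_eq (mulKmx (sl2_unit dM))).
have dF m : \det (forward_cocycle A m w) = 1 by exact: (det_forward A1).
have dB m : \det (backward_cocycle A m w) = 1.
  rewrite (backward_inv A1) // det_invmx1 // (det_forward A1) //.
  exact: shift_toeplitz_subshift.
move=> lim1 l10 lim2 l20.
have vgN : (fun m : nat => vector_growth A w v (- m%:Z)) =
    (fun m : nat => ln (enorm (backward_cocycle A m w *m v)) / m%:R).
  by apply/funext => m; rewrite /vector_growth cocycleN normrN.
rewrite vgN in lim2.
have dec1 := @ln_rate_decay (fun m => enorm (forward_cocycle A m w *m v)) l1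
  (fun m => pos _ (dF m)) l10 lim1.
have dec2 := @ln_rate_decay (fun m => enorm (backward_cocycle A m w *m v)) l2
  (fun m => pos _ (dB m)) l20 lim2.
have [N AN] := Aloc.
pose rr := enorm (forward_cocycle A N.+1 w *m v) / 3.
have rr0 : 0 < rr by have := pos _ (dF N.+1); rewrite /rr; lra.
have [m1 _ m1P] := dec1 rr rr0; have [m2 _ m2P] := dec2 rr rr0.
pose K := (2 * N)%N.
have KN : (2 * N < ell n K)%N by exact: ell_gt.
have [k kb akc] := rc (K + m1 + m2 + N.+1)%N.
have kell := ell_gt n2 k.
have Kk : (K <= k)%N by lia.
have := gordon n2 A1 AN KN v rc Kk akc.
have := m1P (N.+1 + ell n k)%N; have := m2P (ell n k - N.+1)%N.
have := m2P (2 * ell n k - N.+1)%N => /=.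
move=> /(_ ltac:(lia)) le1 /(_ ltac:(lia)) le2 /(_ ltac:(lia)) le3.
by rewrite -/w; move: le1 le2 le3; rewrite /rr; lra.
Qed.

End Growth.

Lemma toeplitz_alpha (Alph : finType) (a : nat -> Alph) (n : nat -> nat) :
  (forall k, 2 <= n k)%N ->
  LSC_alpha (toeplitz_subshift a n)
    (fun j : 'I_#|eventual_alphabet a| => lead a n (enum_val j)).
Proof.
move=> n2; have [K KP] := eventually_recurrent a; exists (ell n K) => m Km.
apply/seteqP; split => [u [w Ow [k ->]]|u [j _ [k /= km <-]]].
  have [l ->] := Ow k m; have [c rc [k' k'm cE]] := factor_lead n2 KP l Km.
  have cA : c \in eventual_alphabet a by apply/recurrentP.
  exists (enum_rank_in cA c) => //; exists k' => //=.
  by rewrite enum_rankK_in //; apply/mkseq_eq => i im; rewrite cE.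
exists (lead a n (enum_val j)); last by exists (- k%:Z + 1).
apply: (lead_subshift n2); apply/recurrentP; exact: enum_valP.
Qed.

Theorem theorem5p5 (R : realType) (Alph : finType) (a : nat -> Alph) (n : nat -> nat)
  (n_ge2 : forall k : nat, (2 <= n k)%N)
  (a_neq : forall k : nat, a k.+1 <> a k)
  (a_event : (2 <= #|eventual_alphabet a|)%N) :
  leading_sequence_condition R (toeplitz_subshift a n) /\
  (forall A : (int -> Alph) -> 'M[R]_2,
     SL2_valued (toeplitz_subshift a n) A ->
     locally_constant (toeplitz_subshift a n) A ->
     uniform_cocycle (toeplitz_subshift a n) A).
Proof.
split=> [|A A1 Aloc]; last exact: toeplitz_uniform.
have rc (j : 'I_#|eventual_alphabet a|) : recurrent a (enum_val j).
  by apply/recurrentP; exact: enum_valP.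
have Oc j := lead_subshift n_ge2 (rc j).
exists #|eventual_alphabet a|, (fun j => lead a n (enum_val j)); split=> //.
- exact: ltnW.
- exact: toeplitz_alpha.
- move=> A A1 Aloc; split; first exact: (toeplitz_beta n_ge2 A1 Aloc Oc).
  by apply: (toeplitz_gamma n_ge2 A1 Aloc) => j; exists (enum_val j).
Qed.
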